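(* Let $n,k$ be integers with $1\le k\le n-1$. Let $\mathcal{A}=\mathbb{C}[p_1,\dots,p_k,q_1,\dots,q_{n-k}]/I\cong H^*(\mathrm{Gr}(k,n),\mathbb{C})$, and let $E,F,H$ be the operators on $\mathcal{A}$ by which the elements $e,f,h$ of Dynkin's principal $\mathfrak{sl}_2$-triple of $\mathfrak{sl}_n(\mathbb{C})$ act (see the context). Then $E,F,H$ are the operators on $\mathcal{A}$ given by the following differential operators (that is, the differential operators below on $\mathbb{C}[p_1,\dots,p_k,q_1,\dots,q_{n-k}]$ descend to the quotient $\mathcal{A}$, where they coincide with $H$, $E$, $F$ respectively): $$H=-2\sum_{j=1}^{k}jp_j\frac{\partial}{\partial p_j}-2\sum_{j=1}^{n-k}jq_j\frac{\partial}{\partial q_j}+k(n-k),$$ $$\begin{aligned}E=&-\sum_{j=1}^{k}(k-j+1)(n-k+j-1)\,p_{j-1}\frac{\partial}{\partial p_j}+\sum_{j=1}^{n-k}(k+j-1)(n-k-j+1)\,q_{j-1}\frac{\partial}{\partial q_j}\\&+\sum_{j,l=1}^{k}\Bigl(\sum_{d=0}^{j-1}(j+l-2d-1)\,p_dp_{j+l-d-1}\Bigr)\frac{\partial^2}{\partial p_j\partial p_l}\\&-\sum_{j,l=1}^{n-k}\Bigl(\sum_{d=0}^{j-1}(j+l-2d-1)\,q_dq_{j+l-d-1}\Bigr)\frac{\partial^2}{\partial q_j\partial q_l}\\&+2\sum_{j=1}^{k}\sum_{l=1}^{n-k}(j+l-1)\Bigl(\sum_{d=0}^{j-1}p_dq_{j+l-d-1}\Bigr)\frac{\partial^2}{\partial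 p_j\partial q_l},\end{aligned}$$ $$F=-p_1.$$ Here an element $a$ of the algebra, used as an operator, denotes multiplication by $a$.
   Context: Grassmannian and bundles. $\mathrm{Gr}(k,n)$ is the Grassmannian of $k$-dimensional subspaces of an $n$-dimensional complex vector space $W$. $T$ is the trivial bundle of rank $n$ with fiber $W$, $S\subset T$ is the universal subbundle (rank $k$), and $Q=T/S$ is the universal quotient bundle (rank $n-k$). The algebra $\mathcal{A}$. Conventions: $p_0=q_0=1$; $p_j=0$ if $j<0$ or $j>k$; $q_l=0$ if $l<0$ or $l>n-k$. $I$ is the ideal of $\mathbb{C}[p_1,\dots,p_k,q_1,\dots,q_{n-k}]$ generated by $R_m=\sum_{r+s=m}p_rq_s$ (sum over $r,s\ge0$) for $1\le m\le n$. The map $p_j\mapsto c_j(S)$, $q_l\mapsto c_l(Q)$ (Chern classes) induces a ring isomorphism $\mathcal{A}\cong H^*(\mathrm{Gr}(k,n),\mathbb{C})$, by which the two are identified. Schubert classes. A partition is a nonincreasing sequence of nonnegative integers. $\mathcal{P}_{k,n}$ is the set of partitions $\lambda=(\lambda_1\ge\dots\ge\lambda_k\ge 0)$ with $\lambda_1\le n-k$; $|\lambda|=\sum_j\lambda_j$. Fix a complete flag $0\subset F_1\subset\dots\subset F_n=W$. For $\lambda\in\mathcal{P}_{k,n}$ the Schubert variety is $\Omega_\lambda=\{U\in\mathrm{Gr}(k,n):\dim(U\cap F_{n-k+j-\lambda_j})\ge j,\ 1\le j\le k\}$, and the Schubert class $\sigma_\lambda\in H^{2|\lambda|}(\mathrm{Gr}(k,n),\mathbb{C})$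 is its Poincaré dual class. The classes $\{\sigma_\lambda\}_{\lambda\in\mathcal{P}_{k,n}}$ form a basis of $H^*(\mathrm{Gr}(k,n),\mathbb{C})$. There is a ring isomorphism from $\Lambda/(s_\lambda\mid\lambda\notin\mathcal{P}_{k,n})$ ($\Lambda$ the ring of symmetric functions over $\mathbb{C}$, $s_\lambda$ the Schur functions) to $H^*(\mathrm{Gr}(k,n),\mathbb{C})$ sending $s_\lambda\mapsto\sigma_\lambda$; under it the complete symmetric function $h_j$ goes to $c_j(Q)=q_j$ and the elementary symmetric function $e_j$ goes to $(-1)^jc_j(S)=(-1)^jp_j$. $\mathfrak{sl}_n$-structure. Let $V=\mathbb{C}^n$ have basis $e_0,\dots,e_{n-1}$. The linear isomorphism $H^*(\mathrm{Gr}(k,n),\mathbb{C})\to\bigwedge^kV$ given by $\sigma_\lambda\mapsto e_{\lambda_1+k-1}\wedge e_{\lambda_2+k-2}\wedge\dots\wedge e_{\lambda_k}$ transports the natural $\mathrm{GL}_n(\mathbb{C})$-action on $\bigwedge^kV$, and hence the actions of $\mathfrak{gl}_n(\mathbb{C})$ and $\mathfrak{sl}_n(\mathbb{C})$, to $H^*(\mathrm{Gr}(k,n),\mathbb{C})\cong\mathcal{A}$. Dynkin's triple. Index rows and columns of matrices by $0,\dots,n-1$, and let $E_{ij}$ be the matrix units (so $E_{ij}e_j=e_i$). Dynkin's principal $\mathfrak{sl}_2$-triple of $\mathfrak{sl}_n(\mathbb{C})$ is $$h=\sum_{j=0}^{n-1}(n-1-2j)E_{jj},\quad e=\sum_{j=1}^{n-1}j(n-j)E_{j-1,j},\quad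 f=\sum_{j=1}^{n-1}E_{j,j-1}.$$ The operators $E,F,H$ are the actions of $e,f,h$ on $H^*(\mathrm{Gr}(k,n),\mathbb{C})\cong\mathcal{A}$. *)

(* Defs.v *)
From HB Require Import structures.
From mathcomp Require Import all_boot all_order all_algebra all_fingroup.
From mathcomp Require Import ring_quotient mpoly complex.
From mathcomp Require Import boolp classical_sets reals.

Set Implicit Arguments.
Unset Strict Implicit.
Unset Printing Implicit Defensive.

Import GRing.Theory.
Local Open Scope ring_scope.
Local Open Scope quotient_scope.

(* The definitions make sense over any field C; the theorem is about C = R[i]
   with R : realType, i.e. the complex numbers. *)

Section PolynomialRing.
Variables (C : fieldType) (k n : nat).

(* C[p_1, ..., p_k, q_1, ..., q_(n-k)]: the variable p_j (1 <= j <= k) is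
   'X_(lshift _ i) and q_j (1 <= j <= n - k) is 'X_(rshift _ i), where i is the
   ordinal of value j - 1. *)
Definition pq_poly := {mpoly C[k + (n - k)]}.

Definition pvar (j : nat) : pq_poly :=
  if j is j'.+1 then
    if insub j' is Some i then 'X_(lshift (n - k) i) else 0
  else 1.

Definition qvar (j : nat) : pq_poly :=
  if j is j'.+1 then
    if insub j' is Some i then 'X_(rshift k i) else 0
  else 1.

Definition relR (m : nat) : pq_poly := \sum_(r < m.+1) pvar r * qvar (m - r).

Definition relI : pq_poly -> bool := fun f =>
  `[< exists g : nat -> pq_poly, f = \sum_(1 <= m < n.+1) g m * relR m >].

Lemma relR_eval0 m : (0 < m)%N -> (relR m).@[fun=> 0] = 0.
Proof.
move=> m0; rewrite /relR raddf_sum big1 //= => r _; rewrite rmorphM /=.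
case: r => -[|r] lt_rm /=.
  rewrite subn0 /qvar; case: m m0 {lt_rm} => // m _.
  by case: insubP => [i _ _|_]; rewrite ?mevalXU ?meval0 mulr0.
by rewrite /pvar; case: insubP => [i _ _|_]; rewrite ?mevalXU ?meval0 mul0r.
Qed.

Lemma relI_idealr : idealr_closed relI.
Proof.
split.
- by apply/asboolP; exists (fun=> 0); rewrite big1 // => m _; rewrite mul0r.
- apply/negP => /asboolP[g /(congr1 (meval (fun=> 0)))].
  rewrite meval1 big_nat_cond raddf_sum big1 /=; last first.
    by move=> m /andP[/andP[m0 _] _]; rewrite rmorphM /= relR_eval0 ?mulr0.
  by move/eqP; rewrite oner_eq0.
- move=> a u v /asboolP[g ->] /asboolP[h ->]; apply/asboolP.
  exists (fun m => a * g m + h m); rewrite mulr_sumr -big_split /=.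
  by apply: eq_bigr => m _; rewrite mulrDl mulrA.
Qed.

HB.instance Definition _ := isIdealr.Build pq_poly relI relI_idealr.

Definition algA := {ideal_quot (relI : idealr pq_poly)}.

HB.instance Definition _ := GRing.ComNzRing.on algA.
HB.instance Definition _ := EqQuotient.on algA.

Definition toA (f : pq_poly) : algA := \pi_algA f.

Lemma toAD f g : toA (f + g) = toA f + toA g.
Proof. by rewrite /toA !piE. Qed.

Lemma toAM f g : toA (f * g) = toA f * toA g.
Proof. by rewrite /toA !piE. Qed.

Lemma toA1 : toA 1 = 1.
Proof. by rewrite /toA !piE. Qed.

(* {ideal_quot _} is only a ring; this is its structure of C-vector space. *)
Definition scaleA (c : C) (a : algA) : algA := toA c%:MP * a.

Lemma scaleAA c d a : scaleA c (scaleA d a) = scaleA (c * d) a.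
Proof. by rewrite /scaleA mulrA -toAM -mpolyCM. Qed.

Lemma scale1A : left_id 1 scaleA.
Proof. by move=> a; rewrite /scaleA mpolyC1 toA1 mul1r. Qed.

Lemma scaleADr : right_distributive scaleA +%R.
Proof. by move=> c a b; rewrite /scaleA mulrDr. Qed.

Lemma scaleADl a : {morph scaleA^~ a : c d / c + d}.
Proof. by move=> c d; rewrite /scaleA mpolyCD toAD mulrDl. Qed.

HB.instance Definition _ := GRing.Zmodule_isLmodule.Build C algA
  scaleAA scale1A scaleADr scaleADl.

End PolynomialRing.

Arguments relI : clear implicits.

Section Schubert.
Variables (C : fieldType) (k n : nat).

(* lam i stands for lambda_(i+1); in the same way i.+1 is the usual 1-based
   index in the exponents k - i.+1 below. *)
Definition in_box (lam : 'I_k -> nat) : Prop :=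
  (forall i j : 'I_k, (i <= j)%N -> (lam j <= lam i)%N) /\
  (forall i, (lam i <= n - k)%N).

Definition alternant (a : 'I_k -> nat) : {mpoly C[k]} :=
  \det (\matrix_(i < k, j < k) ('X_i ^+ a j)).

(* The Schur polynomial s_lam(x_1, ..., x_k), as the quotient of alternants
   a_(lam + delta) / a_delta.  The quotient exists when lam is a partition, and
   it is unique because a_delta is not a zero divisor. *)
Definition schur (lam : 'I_k -> nat) : {mpoly C[k]} :=
  xget 0 [set s | s * alternant (fun j => k - j.+1)%N
                  = alternant (fun j => lam j + (k - j.+1))%N]%classic.

(* The ring morphism e_j |-> (-1)^j p_j from symmetric functions to algA.  As
   p_j = 0 for j > k it kills e_j for j > k, hence it factors through symmetric
   polynomials in k variables; symf g is the unique polynomial in e_1, ..., e_k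
   expressing the symmetric polynomial g. *)
Definition sym_toA (g : {mpoly C[k]}) : algA C k n :=
  toA (symf g \mPo [tuple (-1) ^+ i.+1 * pvar C k n i.+1 | i < k]).

Definition schubert (lam : 'I_k -> nat) : algA C k n := sym_toA (schur lam).

(* The basis of the exterior power consists of the wedges of e_(a 0), ...,
   e_(a (k-1)) in this order, for a strictly increasing; elements are given by
   their coordinates, so that the coordinates of a decomposable vector are the
   k x k minors. *)
Definition incr_seq :=
  {a : {ffun 'I_k -> 'I_n} |
      [forall i : 'I_k, forall j : 'I_k, (i < j)%N ==> (a i < a j)%N]}.

Definition ext_power := {ffun incr_seq -> C^o}.

Definition wedge (v : 'I_k -> 'cV[C]_n) : ext_power :=
  [ffun a : incr_seq => \det (\matrix_(i < k, j < k) v i (val a j) 0)].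

Definition evec (a : nat) : 'cV[C]_n := \col_(i < n) (i == a :> nat)%:R.

(* The action of gl_n, differential of the natural GL_n-action
   g (v_1 /\ ... /\ v_k) = g v_1 /\ ... /\ g v_k: the linear operator given by
   the Leibniz rule X (v_1 /\ ... /\ v_k) = \sum_i v_1 /\ ... /\ X v_i /\ ... /\ v_k
   on basis elements. *)
Definition ext_act (X : 'M[C]_n) (u : ext_power) : ext_power :=
  \sum_(a : incr_seq) u a *:
    \sum_(i < k) wedge (fun j => if j == i then X *m evec (val a j)
                                 else evec (val a j)).

(* theta is the linear isomorphism sigma_lam |-> e_(lam_1 + k - 1) /\ ... /\ e_(lam_k)
   and thetaV its inverse. *)
Definition schubert_iso (theta : {linear algA C k n -> ext_power})
    (thetaV : ext_power -> algA C k n) : Prop :=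
  [/\ cancel theta thetaV, cancel thetaV theta &
      forall lam : 'I_k -> nat, in_box lam ->
        theta (schubert lam) = wedge (fun i => evec (lam i + (k - i.+1)))].

Definition transport (theta : {linear algA C k n -> ext_power})
    (thetaV : ext_power -> algA C k n) (X : 'M[C]_n) :
    algA C k n -> algA C k n :=
  fun a => thetaV (ext_act X (theta a)).

End Schubert.

Section Dynkin.
Variables (C : fieldType) (n : nat).

Definition unit_mx (i j : nat) : 'M[C]_n :=
  \matrix_(a < n, b < n) ((a == i :> nat) && (b == j :> nat))%:R.

Definition dynkin_h : 'M[C]_n :=
  \sum_(0 <= j < n) (n%:R - 1 - 2 * j%:R) *: unit_mx j j.

Definition dynkin_e : 'M[C]_n :=
  \sum_(1 <= j < n) (j%:R * (n%:R - j%:R)) *: unit_mx j.-1 j.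

Definition dynkin_f : 'M[C]_n :=
  \sum_(1 <= j < n) unit_mx j j.-1.

End Dynkin.

Section DifferentialOperators.
Variables (C : fieldType) (k n : nat).

Local Notation p := (pvar C k n).
Local Notation q := (qvar C k n).

Definition dp (i : 'I_k) (f : pq_poly C k n) : pq_poly C k n :=
  f^`M(lshift (n - k) i).
Definition dq (i : 'I_(n - k)) (f : pq_poly C k n) : pq_poly C k n :=
  f^`M(rshift k i).

(* The ordinal i stands for j = i + 1 and i' for l = i' + 1. *)

Definition diffH (f : pq_poly C k n) : pq_poly C k n :=
  - 2 *: (\sum_(i < k) let j := i.+1 in j%:R *: (p j * dp i f))
  - 2 *: (\sum_(i < n - k) let j := i.+1 in j%:R *: (q j * dq i f))
  + (k%:R * (n%:R - k%:R)) *: f.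

Definition diffE (f : pq_poly C k n) : pq_poly C k n :=
  - (\sum_(i < k) let j := i.+1 in
      ((k%:R - j%:R + 1) * (n%:R - k%:R + j%:R - 1)) *: (p (j - 1) * dp i f))
  + (\sum_(i < n - k) let j := i.+1 in
      ((k%:R + j%:R - 1) * (n%:R - k%:R - j%:R + 1)) *: (q (j - 1) * dq i f))
  + (\sum_(i < k) \sum_(i' < k) let j := i.+1 in let l := i'.+1 in
      (\sum_(d < j) (j%:R + l%:R - 2 * d%:R - 1) *:
          (p d * p (j + l - d - 1))) * dp i (dp i' f))
  - (\sum_(i < n - k) \sum_(i' < n - k) let j := i.+1 in let l := i'.+1 in
      (\sum_(d < j) (j%:R + l%:R - 2 * d%:R - 1) *:
          (q d * q (j + l - d - 1))) * dq i (dq i' f))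
  + 2 *: (\sum_(i < k) \sum_(i' < n - k) let j := i.+1 in let l := i'.+1 in
      (j%:R + l%:R - 1) *:
        ((\sum_(d < j) p d * q (j + l - d - 1)) * dp i (dq i' f))).

Definition diffF (f : pq_poly C k n) : pq_poly C k n := - p 1 * f.

Definition descends_to (D : pq_poly C k n -> pq_poly C k n)
    (Dbar : algA C k n -> algA C k n) : Prop :=
  (forall f : pq_poly C k n,
     f \in relI C k n -> D f \in relI C k n) /\
  (forall f, toA (D f) = Dbar (toA f)).

End DifferentialOperators.

(* Main.v *)
From HB Require Import structures.
Require Import Defs.
From mathcomp Require Import all_boot all_order all_algebra all_fingroup.
From mathcomp Require Import ring zify generic_quotient ring_quotient mpoly.
From mathcomp Require Import complex reals.

(* Realize everything on polynomials in x_1, ..., x_k.  Sending p_j to (-1)^j e_j(x) and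
   q_l to h_l(x), and multiplying by the Vandermonde determinant a_delta, maps A to the
   antisymmetric polynomials modulo the ideal (x_1^n, ..., x_k^n), that is to the k-th
   exterior power of C[x]/(x^n); s_lam goes to the alternant a_(lam + delta), hence to the
   wedge of the e_(lam_j + k - j).  Averaging over permutations,
   k! g = \sum_m g_m a_m for g antisymmetric, and a_m / a_delta = 0 in A as soon as some
   m_i >= n, so that the map is injective on A.

   On C[x]/(x^n) with e_j = x^j, the matrices f, h, e act as x, (n-1) - 2 x d/dx and
   (n-1) d/dx - x (d/dx)^2.  Conjugating the induced operators on the exterior power by
   a_delta gives operators of order at most two on symmetric polynomials.  Such an operator
   is determined by its values on the generators p_j, q_l, read off from e_j a_delta and
   h_l a_delta, and by its symbol \sum_i x_i (d_i f)(d_i g) on pairs of generators.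
   The formula for E holds exactly with h_l in place of q_l for all l; as h_l a_delta lies
   in (x_1^n, ..., x_k^n) for l > n - k, one may truncate. *)

Set Implicit Arguments.
Unset Strict Implicit.
Unset Printing Implicit Defensive.

Import GRing.Theory.
Local Open Scope ring_scope.
Local Open Scope quotient_scope.

#[local] Arguments pvar : simpl never.
#[local] Arguments qvar : simpl never.

(** * Remainders of powers modulo a monic polynomial, and Schur functions as their determinants *)

Section Reduction.
Variables (R : comNzRingType) (k : nat).
Implicit Types (p : nat -> R).

(* [monred p a r] is the coefficient of [t ^ r] in the remainder of [t ^ a] modulo
   [\sum_(r <= k) p r * t ^ (k - r)]; it is meaningful for [r < k] only.  For
   [p r = (-1) ^ r e_r(x)], [hred p l] is [h_l(x)] and [schurred p alpha] is the quotient of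
   the alternants of exponents [alpha] and [(k - 1, ..., 0)]. *)
Fixpoint monred p (a r : nat) : R :=
  if a is a'.+1 then
    (if r is r'.+1 then monred p a' r' else 0) - p (k - r)%N * monred p a' k.-1
  else (r == 0)%:R.

Definition hred p (l : nat) : R := monred p (l + k.-1) k.-1.

Definition schurred p (alpha : 'I_k -> nat) : R :=
  \det (\matrix_(r < k, j < k) monred p (alpha j) (k - r.+1)).

Lemma monred_small p a r : (a < k)%N -> monred p a r = (a == r)%:R.
Proof.
elim: a r => [|a IHa] [|r] // lt_ak /=; rewrite ?IHa ?(ltnW lt_ak) //;
  rewrite (_ : a == k.-1 = false) ?mulr0 ?subr0 ?eqSS //;
  by apply/negbTE; rewrite neq_ltn -ltnS (ltn_predK lt_ak) lt_ak.
Qed.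

(** Unrolls the recursion along a diagonal, from index [k.-1 - j] up to the top index: each of the
    [j] steps contributes one term [p r] times a top coefficient. *)
Lemma monred_shift p a j : (j <= k.-1)%N ->
  monred p (a + j) k.-1 =
  monred p a (k.-1 - j) - \sum_(1 <= r < j.+1) p r * monred p (a + j - r) k.-1.
Proof.
move=> le_jk.
have step i : (i <= j)%N -> monred p (a + i) (k.-1 - (j - i)) =
    monred p a (k.-1 - j)
    - \sum_(1 <= r < i.+1) p (r + (j - i))%N * monred p (a + i - r) k.-1.
  elim: i => [|i IHi] lt_ij; first by rewrite big_nil subr0 addn0 subn0.
  rewrite addnS /=.
  case def_r: (k.-1 - (j - i.+1))%N => [|r]; first by exfalso; lia.
  have -> : r = (k.-1 - (j - i))%N by lia.
  rewrite IHi ?(ltnW lt_ij) // [in RHS]big_ltn // opprD addrA addrAC.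
  congr (_ - _ - _); last by congr (p _ * monred p _ _); lia.
  rewrite [in RHS]big_add1; apply: eq_big_nat => r' lt_r'.
  by congr (p _ * monred p _ _); lia.
have := step j (leqnn j); rewrite subnn subn0 => ->; congr (_ - _).
by apply: eq_bigr => r _; rewrite addn0.
Qed.

(** The top coefficients form the inverse of the series of the [p r], as complete symmetric
    polynomials do for the signed elementary ones. *)
Lemma hred_conv p m : (0 < k)%N -> p 0 = 1 ->
    (forall r, (k < r)%N -> p r = 0) ->
  \sum_(r < m.+1) p r * hred p (m - r) = (m == 0)%:R.
Proof.
move=> k0 p0 pk; rewrite big_ord_recl p0 mul1r subn0.
case: m => [|m]; first by rewrite big_ord0 addr0 /hred monred_small ?eqxx // ltn_predL.
apply/eqP; rewrite addr_eq0; apply/eqP.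
have -> : \sum_(i < m.+1) p (bump 0 i) * hred p (m.+1 - bump 0 i)
    = \sum_(1 <= r < m.+2) p r * hred p (m.+1 - r).
  by rewrite big_add1 big_mkord.
(* For [m.+1 < k] the unrolling starts at [t ^ k.-1], which is its own remainder. Otherwise it takes
   [k.-1] steps down to index 0, where the recursion supplies the last term [r = k]. *)
have [le_km|lt_mk] := leqP k m.+1; last first.
  rewrite {1}/hred addnC monred_shift; last by rewrite -ltnS prednK.
  rewrite monred_small ?ltn_predL // (_ : _ == _ = false) ?sub0r; last first.
    by apply/negbTE/eqP; lia.
  congr (- _); apply: eq_big_nat => r lt_r; congr (_ * monred p _ _); lia.
rewrite (big_cat_nat (n := k.+1)) //=.
rewrite [X in _ + X]big_nat_cond [X in _ + X]big1 ?addr0; last first.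
  by move=> r /andP[/andP[/pk-> _] _]; rewrite mul0r.
rewrite {1}/hred (_ : m.+1 + k.-1 = (m.+1 - k).+1 + k.-1 + k.-1)%N; last by lia.
rewrite monred_shift // subnn /= sub0r subn0 prednK // [in RHS]big_nat_recr //=.
rewrite opprD addrC; congr (- _ - _ * monred p _ _).
  by apply: eq_big_nat => r lt_r; congr (_ * monred p _ _); lia.
Qed.

Lemma monred_expr p (x : R) a : (0 < k)%N -> p 0 = 1 ->
    \sum_(r < k.+1) p r * x ^+ (k - r) = 0 ->
  x ^+ a = \sum_(r < k) monred p a r * x ^+ r.
Proof.
move=> k0 p0 px; elim: a => [|a IHa].
  case: k k0 => // k' _; rewrite big_ord_recl mul1r big1 ?addr0 // => i _.
  by rewrite mul0r.
have {}px : x ^+ k = - \sum_(r < k) p (k - r)%N * x ^+ r.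
  move: px; rewrite big_ord_recl p0 mul1r subn0 => /eqP; rewrite addr_eq0 => /eqP->.
  rewrite (reindex_inj rev_ord_inj) /=; congr (- _); apply: eq_bigr => i _.
  by rewrite /bump /= add1n -subSn ?subSS ?subKn // ltnW.

rewrite exprS IHa mulr_sumr.
(* [F] lists the terms of the remainder of [t ^ a] multiplied by [t]; its entry at [k] is the
   overflow, which [px] reduces. *)
pose F r := (if r is r'.+1 then monred p a r' else 0) * x ^+ r.
rewrite [RHS](_ : _ = \sum_(r < k) F r - monred p a k.-1 * \sum_(r < k) p (k - r)%N * x ^+ r).
  rewrite -mulrN -px (eq_bigr (fun i : 'I_k => F i.+1)); last first.
    by move=> i _; rewrite /F exprS mulrCA.
  have -> : monred p a k.-1 * x ^+ k = F k by rewrite /F; case: k k0.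
  by rewrite -(big_ord_recr k (fun r : 'I_k.+1 => F r)) big_ord_recl /= {2}/F mul0r add0r.
by rewrite mulr_sumr -sumrB; apply: eq_bigr => r _; rewrite /F /= mulrBl [p _ * _]mulrC mulrA.
Qed.

(** The bialternant formula at any common system of roots: by [monred_expr] the matrix of powers is
    the Vandermonde matrix times the matrix of remainders. *)
Lemma alt_schurred p (x : 'I_k -> R) (alpha : 'I_k -> nat) : (0 < k)%N -> p 0 = 1 ->
    (forall i, \sum_(r < k.+1) p r * x i ^+ (k - r) = 0) ->
  \det (\matrix_(i < k, j < k) x i ^+ alpha j) =
  schurred p alpha * \det (\matrix_(i < k, j < k) x i ^+ (k - j.+1)).
Proof.
move=> k0 p0 px; rewrite mulrC -det_mulmx; congr (\det _); apply/matrixP=> i j.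
rewrite !mxE (monred_expr _ k0 p0 (px i)) (reindex_inj rev_ord_inj) /=.
by apply: eq_bigr => r _; rewrite !mxE mulrC.
Qed.

Lemma det_setcol (j0 : 'I_k) (v : 'I_k -> R) :
  \det (\matrix_(r < k, j < k) if j == j0 then v r else (r == j)%:R) = v j0.
Proof.
set M := \matrix_(_, _) _.
rewrite (expand_det_row _ j0) (bigD1 j0) //= big1 ?addr0 => [|j ne_j]; last first.
  by rewrite mxE (negbTE ne_j) eq_sym (negbTE ne_j) mul0r.
rewrite mxE eqxx /cofactor -signr_odd oddD addbb expr0 mul1r.
rewrite (_ : row' _ _ = 1%:M) ?det1 ?mulr1 //; apply/matrixP=> r j.
rewrite !mxE eq_sym (negbTE (neq_lift _ _)).
by rewrite (inj_eq lift_inj).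
Qed.

(** Exponents below [k] are their own remainders, so every column but [j0] is a column of the
    identity matrix. *)
Lemma schurred_staircase_set p (j0 : 'I_k) a :
  schurred p (fun j => if j == j0 then a else (k - j.+1)%N) = monred p a (k - j0.+1).
Proof.
rewrite -[RHS](det_setcol j0 (fun r => monred p a (k - r.+1))); congr (\det _).
apply/matrixP=> r j; rewrite !mxE; case: eqP => // _.
rewrite monred_small; last by have := ltn_ord j; lia.
congr (_%:R : R); congr nat_of_bool; rewrite -val_eqE /=.
by have := ltn_ord j; have := ltn_ord r; lia.
Qed.

Lemma monred_k p r : (r < k)%N -> p 0 = 1 -> monred p k r = - p (k - r)%N.
Proof.
move=> lt_rk p0; have k0 : (0 < k)%N by case: (k) lt_rk.
have -> : monred p k r = monred p k.-1.+1 r by rewrite prednK.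
rewrite /= (monred_small p k.-1) ?ltn_predL // eqxx mulr1.
case: r lt_rk => [|r] lt_rk; rewrite ?sub0r // monred_small ?ltn_predL //.
by rewrite (_ : _ == _ = false) ?sub0r //; apply/negbTE/eqP; lia.
Qed.

(* If [hred] vanishes beyond [n - k] then the monic polynomial above divides [t ^ n]. *)
Lemma monred_eq0 p n a r : (0 < k)%N ->
    (forall l, (n < l + k)%N -> hred p l = 0) ->
  (n <= a)%N -> (r < k)%N -> monred p a r = 0.
Proof.
move=> k0 h0 le_na lt_rk.
suff H j b : (n <= b)%N -> (j <= k.-1)%N -> monred p b (k.-1 - j) = 0.
  by rewrite (_ : r = k.-1 - (k.-1 - r))%N ?H //; lia.
move=> le_nb le_jk.
(* Top coefficients are values of [hred], or 0 below degree [k.-1]; [monred_shift] gives the other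
   coefficients from them. *)
have M0 c : (n <= c)%N -> monred p c k.-1 = 0.
  move=> le_nc; have [lt_ck|le_kc] := ltnP c k.-1.
    by rewrite monred_small ?(ltn_eqF lt_ck) // (leq_trans lt_ck) ?leq_pred.
  by have := h0 (c - k.-1)%N; rewrite /hred subnK // => -> //; lia.
have := monred_shift p b le_jk; rewrite M0; last by lia.
rewrite big_nat_cond big1 ?subr0 // => i /andP[/andP[_ lt_i] _].
by rewrite M0 ?mulr0 //; lia.
Qed.

(** A whole column of remainders vanishes; in A this kills the Schur determinants with an exponent
    outside the range. *)
Lemma schurred_eq0 p n (alpha : 'I_k -> nat) (j : 'I_k) :
    (forall l, (n < l + k)%N -> hred p l = 0) ->
  (n <= alpha j)%N -> schurred p alpha = 0.
Proof.
move=> h0 le_n; have k0 : (0 < k)%N := leq_ltn_trans (leq0n _) (ltn_ord j).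
rewrite /schurred (expand_det_col _ j) big1 // => i _.
by rewrite mxE (monred_eq0 k0 h0) ?mul0r //; have := ltn_ord i; lia.
Qed.

End Reduction.

Lemma eq_monred (R : comNzRingType) k (p p' : nat -> R) a r :
  p =1 p' -> monred k p a r = monred k p' a r.
Proof.
by move=> eq_p; elim: a r => //= a IHa r; rewrite eq_p !IHa; case: r => // r; rewrite IHa.
Qed.

Lemma eq_hred (R : comNzRingType) k (p p' : nat -> R) l :
  p =1 p' -> hred k p l = hred k p' l.
Proof. exact: eq_monred. Qed.

Lemma eq_schurred (R : comNzRingType) k (p p' : nat -> R) (alpha : 'I_k -> nat) :
  p =1 p' -> schurred p alpha = schurred p' alpha.
Proof.
by move=> eq_p; congr (\det _); apply/matrixP=> i j; rewrite !mxE (eq_monred _ _ _ eq_p).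
Qed.

Section Map.
Variables (R S : comNzRingType) (k : nat) (f : {rmorphism R -> S}) (p : nat -> R).

Lemma rmorph_monred a r : f (monred k p a r) = monred k (f \o p) a r.
Proof.
elim: a r => [|a IHa] r /=; first by rewrite rmorph_nat.
by rewrite rmorphB rmorphM !IHa; case: r => [|r]; rewrite ?rmorph0 ?IHa.
Qed.

Lemma rmorph_hred l : f (hred k p l) = hred k (f \o p) l.
Proof. exact: rmorph_monred. Qed.

Lemma rmorph_schurred (alpha : 'I_k -> nat) :
  f (schurred p alpha) = schurred (f \o p) alpha.
Proof.
rewrite /schurred -det_map_mx; congr (\det _); apply/matrixP=> i j.
by rewrite !mxE rmorph_monred.
Qed.

End Map.

(** * Elementary and complete symmetric polynomials *)

Section ElementaryComplete.
Variables (k : nat) (C : comNzRingType).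
Local Notation S := {mpoly C[k]}.
Implicit Types (i : 'I_k) (f g : S).

Lemma mcoeff_mulX_mderiv i g m : ('X_i * g^`M(i))@_m = g@_m *+ m i.
Proof.
rewrite {1}[g]mpolyE raddf_sum mulr_sumr raddf_sum /=.
rewrite [in RHS](mpolyE g) raddf_sum /= -sumrMnl; apply: eq_bigr => m' _.
rewrite mderivZ mderivX -!scalerAr -mpolyXD !mcoeffZ !mcoeffX.
have [m'0|m'0] := eqVneq (m' i) 0.
  rewrite m'0 mul0r mulr0; case: eqP => [<-|]; first by rewrite m'0 mulr0n.
  by rewrite mulr0 mul0rn.
rewrite addmC submK ?lep1mP //; case: eqP => [->|_]; last by rewrite !mulr0 mul0rn.
by rewrite !mulr1 mulr_natr.
Qed.

(** The derivative of e_(j+1) in x_i is e_j of the other variables, that is e_j without its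
    monomials divisible by x_i. *)
Lemma mderiv_mesymS i j :
  (mesym k C j.+1)^`M(i) = mesym k C j - 'X_i * (mesym k C j)^`M(i).
Proof.
apply/mpolyP=> m; rewrite mcoeffB mcoeff_mulX_mderiv mcoeff_deriv !mcoeff_mesym.
rewrite /mechar mdegD mdeg1 addn1 eqSS.
case: (mdeg m == j) => /=; last by rewrite !mul0rn subr0.
case def_mi: (m i) => [|[|b]].
- rewrite mulr1n mulr0n subr0; congr (nat_of_bool _)%:R; apply: eq_forallb => l.
  by rewrite mnmDE mnm1E; case: eqP => [<-|]; rewrite ?def_mi ?addn0.
- rewrite mulr1n subrr (_ : [forall _, _] = false) ?mul0rn //.
  by apply/negbTE/forallPn; exists i; rewrite mnmDE mnm1E eqxx def_mi.
- rewrite (_ : [forall _, _] = false); last first.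
    by apply/negbTE/forallPn; exists i; rewrite mnmDE mnm1E eqxx def_mi.
  rewrite (_ : [forall _, _] = false) ?mul0rn ?subr0 //.
  by apply/negbTE/forallPn; exists i; rewrite def_mi.
Qed.

(** With this sign the monic polynomial underlying [monred] is the product of the t - x_i. *)
Definition sesym (j : nat) : S := (-1) ^+ j *: mesym k C j.

(** Complete symmetric polynomials, obtained by reduction instead of as sums of monomials: the
    convolution identity and the alternant formula both follow directly. *)
Definition hsym (l : nat) : S := hred k sesym l.

Lemma sesym0 : sesym 0 = 1. Proof. by rewrite /sesym mesym0E scale1r. Qed.

Lemma sesym_gt j : (k < j)%N -> sesym j = 0.
Proof. by move=> lt_kj; rewrite /sesym mesym_geqnE ?scaler0. Qed.

Lemma mderiv1 i : (1 : S)^`M(i) = 0.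
Proof. by rewrite -mpolyC1 mderivC. Qed.

Lemma mderiv_sesymS i j : (sesym j.+1)^`M(i) = - sesym j + 'X_i * (sesym j)^`M(i).
Proof.
rewrite /sesym !mderivZ mderiv_mesymS exprS mulN1r scaleNr scalerBr opprB.
by rewrite addrC scalerAr.
Qed.

(** Horner's scheme for the division of the product of the t - x_l by t - x_i: both sides are (-1)^m
    e_m of the variables other than x_i. *)
Lemma sesym_horner i m : \sum_(r < m.+1) sesym r * 'X_i ^+ (m - r) = - (sesym m.+1)^`M(i).
Proof.
elim: m => [|m IHm].
  by rewrite big_ord1 mderiv_sesymS sesym0 mderiv1 mulr0 addr0 opprK mulr1.
rewrite big_ord_recr /= subnn mulr1 mderiv_sesymS opprD opprK addrC -mulrN -IHm.
congr (_ + _); rewrite mulr_sumr; apply: eq_bigr => r _.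
by rewrite mulrCA -exprS subSn // -ltnS.
Qed.

Lemma sesym_root i : \sum_(r < k.+1) sesym r * 'X_i ^+ (k - r) = 0.
Proof. by rewrite sesym_horner sesym_gt // raddf0 oppr0. Qed.

Lemma alternant_schurred (alpha : 'I_k -> nat) : (0 < k)%N ->
  \det (\matrix_(i < k, j < k) ('X_i ^+ alpha j : S)) =
  schurred sesym alpha * \det (\matrix_(i < k, j < k) ('X_i ^+ (k - j.+1))).
Proof. by move=> k0; rewrite (alt_schurred _ k0 sesym0 sesym_root). Qed.

Lemma hsym_conv m : (0 < k)%N -> \sum_(r < m.+1) sesym r * hsym (m - r) = (m == 0)%:R.
Proof. by move=> k0; rewrite hred_conv // ?sesym0 //; apply: sesym_gt. Qed.

(* [sesym] is invertible for convolution. *)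
Lemma sesym_conv_eq0 (G : nat -> S) :
  (forall m, \sum_(r < m.+1) sesym r * G (m - r)%N = 0) -> forall m, G m = 0.
Proof.
move=> convG; elim/ltn_ind => m IHm; have := convG m.
rewrite big_ord_recl sesym0 mul1r subn0 big1 ?addr0 // => r _.
by rewrite IHm ?mulr0 //= /bump add1n ltn_subrL /= (leq_ltn_trans _ (ltn_ord r)).
Qed.

Lemma hsym0 : (0 < k)%N -> hsym 0 = 1.
Proof. by move=> k0; have := hsym_conv 0 k0; rewrite big_ord1 sesym0 mul1r. Qed.

Definition euler g : S := \sum_i 'X_i * g^`M(i).

Lemma mcoeff_euler g m : (euler g)@_m = g@_m *+ mdeg m.
Proof.
rewrite /euler raddf_sum /= mdegE -sumrMnr; apply: eq_bigr => i _.
exact: mcoeff_mulX_mderiv.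
Qed.

Lemma eulerM f g : euler (f * g) = euler f * g + f * euler g.
Proof.
rewrite /euler mulr_suml mulr_sumr -big_split; apply: eq_bigr => i _ /=.
by rewrite mderivM; ring.
Qed.

Lemma euler_sum I r (P : pred I) (F : I -> S) :
  euler (\sum_(x <- r | P x) F x) = \sum_(x <- r | P x) euler (F x).
Proof.
rewrite /euler exchange_big; apply: eq_bigr => i _.
by rewrite raddf_sum mulr_sumr.
Qed.

Lemma euler_sesym j : euler (sesym j) = sesym j *+ j.
Proof.
apply/mpolyP=> m; rewrite mcoeff_euler mcoeffMn /sesym mcoeffZ.
have [->//|ne_j] := eqVneq (mdeg m) j.
rewrite (dhomog_nemf_coeff (dhomog_mesym _ _ j) ne_j).
by rewrite mulr0 !mul0rn.
Qed.

(** The derivation [euler] kills the constants on the right of [hsym_conv], so the defect of this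
    identity has zero convolution with [sesym]. *)
Lemma euler_hsym l : (0 < k)%N -> euler (hsym l) = hsym l *+ l.
Proof.
move=> k0; apply/eqP; rewrite -subr_eq0; apply/eqP; move: l.
apply: sesym_conv_eq0 => m.
rewrite (eq_bigr (fun r : 'I_m.+1 =>
  euler (sesym r * hsym (m - r)) - sesym r * hsym (m - r) *+ m)).
  rewrite sumrB -euler_sum sumrMnl hsym_conv //.
  rewrite (_ : euler _ = 0) ?sub0r; last first.
    rewrite /euler big1 // => i _.
    by case: eqP; rewrite ?raddf0 ?mderiv1 ?mulr0.
  by case: m => [|m]; rewrite ?mulr0n ?mul0rn oppr0.
move=> r _; rewrite eulerM euler_sesym.
have -> : sesym r * hsym (m - r) *+ m =
    sesym r * hsym (m - r) *+ r + sesym r * hsym (m - r) *+ (m - r).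
  by rewrite -mulrnDr subnKC // -ltnS.
by rewrite mulrBr mulrnAl mulrnAr [RHS]addrAC opprD addrA addrN sub0r addrC.
Qed.

(** Obtained by differentiating [hsym_conv] in degrees [m] and [m.+1], and comparing through the
    recursion for [sesym]. *)
Lemma mderiv_hsymS i l : (0 < k)%N ->
  (hsym l.+1)^`M(i) = hsym l + 'X_i * (hsym l)^`M(i).
Proof.
move=> k0; apply/eqP; rewrite eq_sym -subr_eq0; apply/eqP; move: l.
apply: sesym_conv_eq0 => m.
have dconv m' : \sum_(r < m'.+1) (sesym r)^`M(i) * hsym (m' - r)
    + \sum_(r < m'.+1) sesym r * (hsym (m' - r))^`M(i) = 0.
  have := hsym_conv m' k0 => /(congr1 (mderiv i)).
  rewrite raddf_sum -big_split /= (_ : (_ %:R)^`M(i) = 0); last first.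
    by case: eqP; rewrite ?raddf0 ?mderiv1.
  by move=> dH; rewrite -[RHS]dH; apply: eq_bigr => r _; rewrite mderivM.
have := dconv m.+1; rewrite big_ord_recl [X in _ + X = _]big_ord_recr /=.
rewrite sesym0 mderiv1 mul0r add0r subnn hsym0 // mderiv1 mulr0 addr0.
rewrite (eq_bigr (fun r : 'I_m.+1 =>
  'X_i * ((sesym r)^`M(i) * hsym (m - r)) - sesym r * hsym (m - r))); last first.
  move=> r _; rewrite mderiv_sesymS subSS; ring.
rewrite sumrB -mulr_sumr.
move: (dconv m); move/eqP; rewrite addr_eq0 => /eqP -> dH.
rewrite -[RHS]oppr0 -[X in - X]dH opprD opprB mulrN opprK mulr_sumr.
rewrite -big_split -sumrB /=; apply: eq_bigr => r _.
by rewrite subSn -1?ltnS //; ring.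
Qed.

Lemma sum_mderiv_sesymS j : \sum_i (sesym j.+1)^`M(i) = (j%:R - k%:R) * sesym j.
Proof.
rewrite (eq_bigr _ (fun i _ => mderiv_sesymS i j)) big_split /= -/(euler _) euler_sesym.
by rewrite sumr_const card_ord -mulNrn -mulr_natl; ring.
Qed.

Lemma sum_mderiv_hsymS l : (0 < k)%N -> \sum_i (hsym l.+1)^`M(i) = (k%:R + l%:R) * hsym l.
Proof.
move=> k0; rewrite (eq_bigr _ (fun i _ => mderiv_hsymS i l k0)) big_split /= -/(euler _).
by rewrite euler_hsym // sumr_const card_ord; ring.
Qed.

Definition symbol f g : S := \sum_i 'X_i * (f^`M(i) * g^`M(i)).

(* Since [x_i d_i(u_j) = d_i(u_(j+1)) - cu u_j], and likewise for [v], moving one degree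
   from [v] to [u] changes the symbol by a multiple of [u_j v_l]: the sum telescopes. *)
Lemma symbol_conv (u v : nat -> S) (cu cv : S) (wu wv : nat -> S) :
    u 0 = 1 ->
    (forall i j, (u j.+1)^`M(i) = cu * u j + 'X_i * (u j)^`M(i)) ->
    (forall i j, (v j.+1)^`M(i) = cv * v j + 'X_i * (v j)^`M(i)) ->
    (forall j, \sum_i (u j.+1)^`M(i) = wu j * u j) ->
    (forall j, \sum_i (v j.+1)^`M(i) = wv j * v j) ->
  forall j l, symbol (u j) (v l) =
    \sum_(d < j) (cu * wv (j + l - d - 1)%N - cv * wu d)
       * (u d * v (j + l - d - 1)%N).
Proof.
move=> u0 du dv su sv; elim=> [|j IHj] l.
  by rewrite big_ord0 u0 /symbol big1 // => i _; rewrite mderiv1 mul0r mulr0.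
rewrite big_ord_recr /= (_ : j.+1 + l - j - 1 = l)%N; last by lia.
have -> : symbol (u j.+1) (v l) = symbol (u j) (v l.+1)
    + (cu * u j * \sum_i (v l.+1)^`M(i) - cv * v l * \sum_i (u j.+1)^`M(i)).
  rewrite /symbol !mulr_sumr -sumrB -big_split; apply: eq_bigr => i _ /=.
  by rewrite du dv; ring.
rewrite su sv IHj addSnnS; congr (_ + _); ring.
Qed.

(** The weights -(j+l-d-1-k) + (d-k) of [symbol_conv] add up to an expression free of [k]. *)
Lemma symbol_sesym j l : symbol (sesym j) (sesym l) =
  - \sum_(d < j) (j%:R + l%:R - 2 * d%:R - 1) * (sesym d * sesym (j + l - d - 1)%N).
Proof.
rewrite (@symbol_conv sesym sesym (-1) (-1) (fun j => j%:R - k%:R) (fun j => j%:R - k%:R)) //.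
- rewrite -sumrN; apply: eq_bigr => d _; have lt_dj := ltn_ord d.
  by rewrite !natrB ?natrD ?leq_subRL; try lia; ring.
- exact: sesym0.
- by move=> i j'; rewrite mderiv_sesymS mulN1r.
- by move=> i j'; rewrite mderiv_sesymS mulN1r.
- exact: sum_mderiv_sesymS.
- exact: sum_mderiv_sesymS.
Qed.

Lemma symbol_hsym j l : (0 < k)%N -> symbol (hsym j) (hsym l) =
  \sum_(d < j) (j%:R + l%:R - 2 * d%:R - 1) * (hsym d * hsym (j + l - d - 1)%N).
Proof.
move=> k0.
rewrite (@symbol_conv hsym hsym 1 1 (fun j => k%:R + j%:R) (fun j => k%:R + j%:R)) //.
- apply: eq_bigr => d _; have lt_dj := ltn_ord d.
  by rewrite !natrB ?natrD ?leq_subRL; try lia; ring.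
- exact: hsym0.
- by move=> i j'; rewrite mderiv_hsymS // mul1r.
- by move=> i j'; rewrite mderiv_hsymS // mul1r.
- by move=> j'; apply: sum_mderiv_hsymS.
- by move=> j'; apply: sum_mderiv_hsymS.
Qed.

(** Here the weights -(k+j+l-d-1) - (d-k) do not depend on [d], so that they leave the sum. *)
Lemma symbol_sesym_hsym j l : (0 < k)%N -> (0 < l)%N -> symbol (sesym j) (hsym l) =
  - ((j%:R + l%:R - 1) * \sum_(d < j) sesym d * hsym (j + l - d - 1)%N).
Proof.
move=> k0 l0.
rewrite (@symbol_conv sesym hsym (-1) 1 (fun j => j%:R - k%:R) (fun j => k%:R + j%:R)) //.
- rewrite mulr_sumr -sumrN; apply: eq_bigr => d _; have lt_dj := ltn_ord d.
  by rewrite !natrB ?natrD ?leq_subRL; try lia; ring.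
- exact: sesym0.
- by move=> i j'; rewrite mderiv_sesymS mulN1r.
- by move=> i j'; rewrite mderiv_hsymS // mul1r.
- exact: sum_mderiv_sesymS.
- by move=> j'; apply: sum_mderiv_hsymS.
Qed.

End ElementaryComplete.

(** * Antisymmetric polynomials and the exterior power *)

Section Alternants.
Variables (C : fieldType) (k : nat).
Local Notation S := {mpoly C[k]}.
Implicit Types (alpha : 'I_k -> nat) (g : S) (s : 'S_k).

Definition mset (m : 'X_{1..k}) (i : 'I_k) (v : nat) : 'X_{1..k} :=
  [multinom (if l == i then v else m l) | l < k].

Definition upd alpha (j : 'I_k) (v : nat) : 'I_k -> nat :=
  fun l => if l == j then v else alpha l.

Lemma alternantE alpha :
  alternant C alpha = \sum_(s : 'S_k) (-1) ^+ s *: 'X_[[multinom alpha (s i) | i < k]].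
Proof.
apply: eq_bigr => s _; rewrite -[in RHS]mul_mpolyC rmorph_sign; congr (_ * _).
by rewrite mpolyXE_id; apply: eq_bigr => i _; rewrite mxE mnmE.
Qed.

Lemma eq_alternant alpha alpha' : alpha =1 alpha' -> alternant C alpha = alternant C alpha'.
Proof.
by move=> eq_a; congr (\det _); apply/matrixP=> i j; rewrite !mxE eq_a.
Qed.

Lemma alternant_perm alpha s :
  alternant C (fun j => alpha (s j)) = (-1) ^+ s *: alternant C alpha.
Proof.
rewrite -mul_mpolyC rmorph_sign -odd_permV -det_perm mulrC -det_mulmx -col_permE.
by congr (\det _); apply/matrixP=> i j; rewrite !mxE.
Qed.

Lemma alternant_eq alpha i j : i != j -> alpha i = alpha j -> alternant C alpha = 0.
Proof.
move=> ne_ij eq_a; rewrite /alternant -det_tr.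
by apply: (determinant_alternate ne_ij) => l; rewrite !mxE eq_a.
Qed.

Definition antisym g := forall s, msym s g = (-1) ^+ s *: g.

Lemma msym_alternant s alpha : msym s (alternant C alpha) = (-1) ^+ s *: alternant C alpha.
Proof.
rewrite !alternantE raddf_sum scaler_sumr /= [LHS](reindex_inj (mulgI s)) /=.
apply: eq_bigr => t _; rewrite msymZ msymX scalerA odd_permM signr_addb.
congr (_ *: 'X_[_]); apply/mnmP=> i; by rewrite !mnmE permM permKV.
Qed.

Lemma antisym_sum g : antisym g ->
  k`!%:R *: g = \sum_(m <- msupp g) g@_m *: alternant C m.
Proof.
move=> asym.
(* Each of the k! signed terms is [g] itself; expanded on monomials, the same sum antisymmetrizes
   each monomial into an alternant. *)
transitivity (\sum_(s : 'S_k) (-1) ^+ s *: msym s g).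
  rewrite (eq_bigr (fun=> g)) => [|s _]; last by rewrite asym scalerA -signr_addb addbb scale1r.
  by rewrite sumr_const card_Sn scaler_nat.
rewrite (eq_bigr (fun s : 'S_k => \sum_(m <- msupp g) g@_m *: ((-1) ^+ s *: msym s 'X_[m]))).
  rewrite exchange_big /=; apply: eq_bigr => m _; rewrite -scaler_sumr; congr (_ *: _).
  rewrite alternantE (reindex_inj invg_inj) /=; apply: eq_bigr => s _.
  by rewrite odd_permV msymX invgK.
move=> s _; rewrite {1}[g]mpolyE (raddf_sum (msym s)) scaler_sumr; apply: eq_bigr => m _ /=.
by rewrite msymZ !scalerA mulrC.
Qed.

(* Membership in the ideal [(x_1 ^ n, ..., x_k ^ n)]. *)
Definition vanish n g := forall m : 'X_{1..k}, (forall i, m i < n)%N -> g@_m = 0.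

Lemma vanish0 n : vanish n 0. Proof. by move=> m _; rewrite mcoeff0. Qed.

Lemma vanishD n f g : vanish n f -> vanish n g -> vanish n (f + g).
Proof. by move=> vf vg m lt_m; rewrite mcoeffD vf // vg // addr0. Qed.

Lemma vanishZ n c g : vanish n g -> vanish n (c *: g).
Proof. by move=> vg m lt_m; rewrite mcoeffZ vg // mulr0. Qed.

Lemma vanishN n g : vanish n g -> vanish n (- g).
Proof. by move=> vg m lt_m; rewrite mcoeffN vg // oppr0. Qed.

Lemma vanish_sum n I (r : seq I) (P : pred I) (F : I -> S) :
  (forall x, P x -> vanish n (F x)) -> vanish n (\sum_(x <- r | P x) F x).
Proof. by move=> vF m lt_m; rewrite raddf_sum big1 // => x Px; apply: vF. Qed.

Lemma vanishX n (m : 'X_{1..k}) i : (n <= m i)%N -> vanish n 'X_[m].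
Proof.
move=> le_n m' lt_m'; rewrite mcoeffX; case: eqP => // eq_m.
by have := lt_m' i; rewrite -eq_m ltnNge le_n.
Qed.

Lemma vanish_linear n (T : {linear S -> S}) g :
    (forall (m : 'X_{1..k}) i, (n <= m i)%N -> vanish n (T 'X_[m])) ->
  vanish n g -> vanish n (T g).
Proof.
move=> vT vg; rewrite [g]mpolyE raddf_sum /=; apply: vanish_sum => m _.
rewrite linearZZ; have [/forallP lt_m|] := boolP [forall i, m i < n]%N.
  by rewrite vg // scale0r; apply: vanish0.
by case/forallPn => i; rewrite -leqNgt => /vT ?; apply: vanishZ.
Qed.

Lemma vanishMl n f g : vanish n g -> vanish n (f * g).
Proof.
move=> vg; rewrite [f]mpolyE mulr_suml; apply: vanish_sum => m _.
rewrite -scalerAl; apply: vanishZ.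
apply: (@vanish_linear n (GRing.mull_fun 'X_[m] idfun)) vg => m' i le_n.
by rewrite /= -mpolyXD; apply: (@vanishX _ _ i); rewrite mnmDE (leq_trans le_n) ?leq_addl.
Qed.

Lemma vanish_alternant n alpha j : (n <= alpha j)%N -> vanish n (alternant C alpha).
Proof.
move=> le_n; rewrite alternantE; apply: vanish_sum => s _; apply: vanishZ.
by apply: (@vanishX _ _ (s^-1 j)%g); rewrite mnmE permKV.
Qed.

Section MonomialOperator.
Variables (T : {linear S -> S}) (tau : nat -> C) (sh : nat -> nat).
Hypothesis TX : forall m : 'X_{1..k},
  T 'X_[m] = \sum_i tau (m i) *: 'X_[mset m i (sh (m i))].

(** [T] applies x^m |-> tau m x^(sh m) to one variable at a time, in the same way for all variables;
    on an alternant it therefore changes one exponent at a time, like the Leibniz rule on a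
    wedge. *)
Lemma monop_alternant alpha :
  T (alternant C alpha) = \sum_j tau (alpha j) *: alternant C (upd alpha j (sh (alpha j))).
Proof.
rewrite alternantE raddf_sum /=.
under [RHS]eq_bigr do rewrite alternantE scaler_sumr.
rewrite exchange_big; apply: eq_bigr => s _ /=.
rewrite linearZZ TX scaler_sumr [RHS](reindex_inj (perm_inj (s := s))) /=.
apply: eq_bigr => i _; rewrite !scalerA mulrC mnmE; congr (_ *: 'X_[_]).
by apply/mnmP=> l; rewrite !mnmE /upd (inj_eq perm_inj).
Qed.

(** The hypothesis says that the one-variable operator preserves the ideal (x^n). *)
Lemma monop_vanish n g :
    (forall m, (n <= m)%N -> tau m = 0 \/ (n <= sh m)%N) ->
  vanish n g -> vanish n (T g).
Proof.
move=> hn; apply: vanish_linear => m i le_n; rewrite TX; apply: vanish_sum => l _.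
have [<-|ne_li] := eqVneq i l; last first.
  by apply/vanishZ/(@vanishX _ _ i); rewrite mnmE (negbTE ne_li).
have [->|le_sh] := hn _ le_n; first by rewrite scale0r; apply: vanish0.
by apply/vanishZ/(@vanishX _ _ i); rewrite mnmE eqxx.
Qed.

End MonomialOperator.

End Alternants.

Section Coordinates.
Variables (C : fieldType) (k n : nat).
Local Notation S := {mpoly C[k]}.
Implicit Types (alpha : 'I_k -> nat) (g : S) (a b : incr_seq k n).

Definition seq_nat a : 'I_k -> nat := fun i => val a i.

Definition coords g : ext_power C k n :=
  [ffun a => g@_[multinom seq_nat a i | i < k]].

Lemma coords_is_linear : linear coords.
Proof. by move=> c f g; apply/ffunP=> a; rewrite !ffunE mcoeffD mcoeffZ. Qed.

HB.instance Definition _ := GRing.isLinear.Build C S (ext_power C k n) _ coords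
  coords_is_linear.

Lemma vanish_coords g : vanish n g -> coords g = 0.
Proof. by move=> vg; apply/ffunP=> a; rewrite !ffunE vg // => i; rewrite mnmE ltn_ord. Qed.

(** Both coordinates at [a] count with sign the permutations that carry [alpha] to [a]: one on
    monomials, the other in a minor. *)
Lemma coords_alternant alpha : coords (alternant C alpha) = wedge (fun i => evec C n (alpha i)).
Proof.
apply/ffunP=> a; rewrite !ffunE alternantE raddf_sum -det_tr; apply: eq_bigr => s _ /=.
rewrite mcoeffZ mcoeffX; congr (_ * _).
case: eqP => [/mnmP eq_m|ne_m].
  rewrite big1 // => i _; rewrite !mxE; move: (eq_m i); rewrite !mnmE /seq_nat => ->.
  by rewrite eqxx.
have [i ne_i] : exists i, alpha (s i) != val a i :> nat.
  apply/forallPn/negP=> /forallP eq_a; case: ne_m.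
  by apply/mnmP=> i; rewrite !mnmE (eqP (eq_a i)).
by rewrite (bigD1 i) //= !mxE eq_sym (negbTE ne_i) mul0r.
Qed.

Lemma sorted_seq_nat a : sorted ltn [seq seq_nat a i | i <- enum 'I_k].
Proof.
rewrite sorted_map; have := iota_ltn_sorted 0 k; rewrite -val_enum_ord sorted_map.
by apply: sub_sorted => i j; apply/implyP; have /forallP/(_ i)/forallP/(_ j) := valP a.
Qed.

Lemma seq_nat_inj a : injective (seq_nat a).
Proof.
have lt_a (i j : 'I_k) : (i < j)%N -> (seq_nat a i < seq_nat a j)%N.
  by apply/implyP; have /forallP/(_ i)/forallP/(_ j) := valP a.
move=> i j eq_a; apply/val_inj => /=.
by case: (ltngtP i j) => // /lt_a; rewrite eq_a ltnn.
Qed.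

Lemma incr_seq_perm_eq a b (s : 'S_k) :
  (forall i, seq_nat a (s i) = seq_nat b i) -> a = b.
Proof.
move=> eq_ab; have: [seq seq_nat a i | i <- enum 'I_k] = [seq seq_nat b i | i <- enum 'I_k].
  apply: (irr_sorted_eq ltn_trans ltnn) (sorted_seq_nat a) (sorted_seq_nat b) _ => x.
  apply/mapP/mapP => -[i _ ->].
    by exists (s^-1 i)%g; rewrite ?mem_enum // -eq_ab permKV.
  by exists (s i); rewrite ?mem_enum // -eq_ab.
move/eq_in_map => eq_a; apply/val_inj/ffunP => i; apply/val_inj.
by apply: eq_a; rewrite mem_enum.
Qed.

Lemma coords_basis a b : coords (alternant C (seq_nat a)) b = (a == b)%:R.
Proof.
rewrite ffunE alternantE raddf_sum (bigD1 1%g) //= big1 ?addr0 => [|s ne_s1].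
  rewrite odd_perm1 scale1r mcoeffX; congr (nat_of_bool _)%:R; apply/eqP/eqP => [|->].
    move/mnmP=> eq_ab; apply: (@incr_seq_perm_eq a b 1%g) => i.
    by have := eq_ab i; rewrite !mnmE.
  by apply/mnmP=> i; rewrite !mnmE perm1.
rewrite mcoeffZ mcoeffX; case: eqP => [/mnmP eq_ab|_]; last by rewrite mulr0.
have eq_s i : seq_nat a (s i) = seq_nat b i by have := eq_ab i; rewrite !mnmE.
case/eqP: ne_s1; apply/permP => i; rewrite perm1; apply: (@seq_nat_inj b).
by rewrite -{1}(incr_seq_perm_eq eq_s).
Qed.

Lemma exists_incr_seq alpha : injective alpha -> (forall i, alpha i < n)%N ->
  exists (a : incr_seq k n) (s : 'S_k), forall i, seq_nat a i = alpha (s i).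
Proof.
move=> inj_alpha lt_alpha; pose t := [tuple alpha i | i < k].
have /tuple_permP[s eq_s] : perm_eq (sort leq t) t by rewrite perm_sort.
have nth_t (i : 'I_k) : nth 0%N (sort leq t) i = alpha (s i).
  by rewrite eq_s -tnth_nth !tnth_mktuple.
have srt_t : sorted ltn (sort leq t).
  rewrite ltn_sorted_uniq_leq sort_uniq sort_sorted ?andbT; last exact: leq_total.
  by rewrite map_inj_uniq ?enum_uniq.
pose a0 := [ffun i => Ordinal (lt_alpha (s i))].
have incr_a0 : [forall i : 'I_k, forall j : 'I_k, (i < j)%N ==> (a0 i < a0 j)%N].
  apply/forallP=> i; apply/forallP=> j; apply/implyP=> lt_ij; rewrite !ffunE /= -!nth_t.
  by apply: (sorted_ltn_nth ltn_trans 0%N srt_t); rewrite // inE size_sort size_tuple.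
by exists (exist _ a0 incr_a0), s => i; rewrite /seq_nat /= ffunE.
Qed.

(** A coefficient at distinct exponents is, up to sign, a coefficient at increasing ones. At
    repeated exponents a transposition makes it its own opposite, hence 0 in characteristic 0. *)
Lemma antisym_vanish g : [pchar C] =i pred0 -> antisym g -> coords g = 0 -> vanish n g.
Proof.
move=> char0 asym cg m lt_m.
have perm_coeff (s : 'S_k) : g@_[multinom m (s i) | i < k] = (-1) ^+ s * g@_m.
  by rewrite -mcoeff_sym asym mcoeffZ.
have [/injectiveP inj_m|/injectivePn[i [j ne_ij eq_m]]] := boolP (injectiveb m).
  have [a [s eq_a]] := exists_incr_seq inj_m lt_m.
  move: cg => /ffunP/(_ a); rewrite !ffunE.
  rewrite (_ : [multinom _ | _ < _] = [multinom m (s i) | i < k]).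
    by rewrite perm_coeff => /eqP; rewrite mulf_eq0 signr_eq0 => /eqP.
  by apply/mnmP=> i; rewrite !mnmE.
have := perm_coeff (tperm i j); rewrite odd_tperm ne_ij mulN1r.
rewrite (_ : [multinom _ | _ < _] = m); last first.
  by apply/mnmP=> l; rewrite mnmE; case: tpermP => // ->.
move/eqP; rewrite -addr_eq0 -mulr2n -mulr_natl mulf_eq0.
by move/pcharf0P: char0 => ->; move/eqP.
Qed.

End Coordinates.

Section ExteriorAction.
Variables (C : fieldType) (k n : nat).
Local Notation S := {mpoly C[k]}.
Implicit Types (g : S) (a b : incr_seq k n).

Lemma eq_wedge (v w : 'I_k -> 'cV[C]_n) : v =1 w -> wedge v = wedge w.
Proof.
move=> eq_vw; apply/ffunP=> a; rewrite !ffunE; congr (\det _).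
by apply/matrixP=> i j; rewrite !mxE eq_vw.
Qed.

Lemma wedge_scale i (c : C) (w : 'cV[C]_n) (v : 'I_k -> 'cV[C]_n) :
  wedge (fun j => if j == i then c *: w else v j) =
  c *: wedge (fun j => if j == i then w else v j).
Proof.
apply/ffunP=> a; rewrite !ffunE.
pose M : 'M[C]_k := \matrix_(r, j) (if r == i then w else v r) (val a j) 0.
(* Multilinearity is available for a combination of two rows; the second one gets coefficient 0. *)
rewrite [RHS](_ : _ = c * \det M + 0 * \det M); last by rewrite mul0r addr0.
apply: (@determinant_multilinear _ _ _ _ _ i).
- by apply/rowP=> j; rewrite !mxE eqxx !mxE mul0r addr0.
- by apply/matrixP=> r j; rewrite !mxE eq_sym (negbTE (neq_lift _ _)).
- by apply/matrixP=> r j; rewrite !mxE eq_sym (negbTE (neq_lift _ _)).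
Qed.

Variables (X : 'M[C]_n) (T : {linear S -> S}) (tau : nat -> C) (sh : nat -> nat).
Hypothesis TX : forall m : 'X_{1..k},
  T 'X_[m] = \sum_i tau (m i) *: 'X_[mset m i (sh (m i))].
Hypothesis Xevec : forall m, (m < n)%N -> X *m evec C n m = tau m *: evec C n (sh m).
Hypothesis tau_ge : forall m, (n <= m)%N -> tau m = 0 \/ (n <= sh m)%N.

Lemma ext_act_alternants (u : ext_power C k n) :
  ext_act X u = coords n (T (\sum_a u a *: alternant C (seq_nat a))).
Proof.
rewrite raddf_sum raddf_sum /=; apply: eq_bigr => a _.
rewrite 2!linearZ /=; congr (_ *: _).
rewrite (monop_alternant TX) raddf_sum /=; apply: eq_bigr => i _.
rewrite linearZ /= coords_alternant.
rewrite (_ : wedge _ = wedge (fun j => if j == i then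
    tau (val a i) *: evec C n (sh (val a i)) else evec C n (val a j))); last first.
  by apply: eq_wedge => j; case: eqP => // ->; rewrite Xevec.
rewrite wedge_scale; congr (_ *: _); apply: eq_wedge => j; rewrite /upd.
by case: eqP.
Qed.

Lemma antisym_alternants (u : ext_power C k n) :
  antisym (\sum_a u a *: alternant C (seq_nat a)).
Proof.
move=> s; rewrite raddf_sum scaler_sumr; apply: eq_bigr => a _ /=.
by rewrite msymZ msym_alternant !scalerA mulrC.
Qed.

(** [g] may be replaced by the combination of alternants with the same coordinates: the difference
    is antisymmetric with zero coordinates, so it lies in the ideal, which [T] preserves. *)
Lemma ext_act_coords g : [pchar C] =i pred0 -> antisym g ->
  ext_act X (coords n g) = coords n (T g).
Proof.
move=> char0 asym; rewrite ext_act_alternants; set g' := \sum_a _.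
apply/eqP; rewrite -subr_eq0 -raddfB -raddfB; apply/eqP/vanish_coords.
apply: (monop_vanish TX tau_ge); apply: antisym_vanish => //.
  move=> s; rewrite msymB asym scalerBr; congr (_ - _); exact: antisym_alternants.
rewrite raddfB /g' raddf_sum; apply/eqP; rewrite subr_eq0; apply/eqP/ffunP => b.
rewrite sum_ffunE (bigD1 b) //= big1 ?addr0 => [|a ne_ab].
  by rewrite linearZ ffunE /= coords_basis eqxx [_ *: _]mulr1.
by rewrite linearZ ffunE /= coords_basis (negbTE ne_ab) scaler0.
Qed.

End ExteriorAction.

Lemma sum_staircase (R : comNzRingType) k :
  2 * \sum_(j < k) (k - j.+1)%:R = k%:R * (k%:R - 1) :> R.
Proof.
elim: k => [|k IHk]; first by rewrite big_ord0 mulr0 mul0r.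
rewrite big_ord_recl subn1 mulrDr (eq_bigr (fun j : 'I_k => (k - j.+1)%:R)) // IHk.
by rewrite -natr1; ring.
Qed.

(** * The differential operators *)

Section Operators.
Variables (C : fieldType) (k n : nat).
Local Notation S := {mpoly C[k]}.
Implicit Types (g : S) (alpha : 'I_k -> nat).

(* The operators induced by [x], [(n-1) - 2 x d/dx] and [(n-1) d/dx - x (d/dx)^2], by which
   the matrices f, h and e act on [e_j = x ^ j]. *)
Definition opF g : S := (\sum_i 'X_i) * g.
Definition opH g : S := \sum_i ((n%:R - 1) *: g - 2 *: ('X_i * g^`M(i))).
Definition opE g : S := \sum_i ((n%:R - 1) *: g^`M(i) - 'X_i * g^`M(i)^`M(i)).

Lemma opF_is_linear : linear opF.
Proof. by move=> c f g; rewrite /opF mulrDr -scalerAr. Qed.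
HB.instance Definition _ := GRing.isLinear.Build C S S _ opF opF_is_linear.

Lemma opH_is_linear : linear opH.
Proof.
move=> c f g; rewrite /opH scaler_sumr -big_split; apply: eq_bigr => i _ /=.
by rewrite mderivD mderivZ; rewrite -!mul_mpolyC; ring.
Qed.
HB.instance Definition _ := GRing.isLinear.Build C S S _ opH opH_is_linear.

Lemma opE_is_linear : linear opE.
Proof.
move=> c f g; rewrite /opE scaler_sumr -big_split; apply: eq_bigr => i _ /=.
by rewrite !(mderivD, mderivZ) -!mul_mpolyC; ring.
Qed.
HB.instance Definition _ := GRing.isLinear.Build C S S _ opE opE_is_linear.

Definition tauH m : C := n%:R - 1 - 2 * m%:R.
(** From (n-1) m - m (m-1) = m (n-m). *)
Definition tauE m : C := m%:R * (n%:R - m%:R).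

Lemma opFX (m : 'X_{1..k}) : opF 'X_[m] = \sum_i 1 *: 'X_[mset m i (m i).+1].
Proof.
rewrite /opF mulr_suml; apply: eq_bigr => i _; rewrite scale1r -mpolyXD.
by congr 'X_[_]; apply/mnmP=> l; rewrite !mnmE eq_sym; case: eqP => // ->.
Qed.

Lemma opHX (m : 'X_{1..k}) : opH 'X_[m] = \sum_i tauH (m i) *: 'X_[mset m i (m i)].
Proof.
apply: eq_bigr => i _; rewrite (_ : mset m i (m i) = m); last first.
  by apply/mnmP=> l; rewrite !mnmE; case: eqP => // ->.
rewrite (_ : 'X_i * _ = (m i)%:R *: 'X_[m]); last first.
  apply/mpolyP=> m'; rewrite mcoeff_mulX_mderiv mcoeffZ mcoeffX mulr_natl.
  by case: eqP => [->|]; rewrite ?mul0rn.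
by rewrite /tauH -!mul_mpolyC; ring.
Qed.

Lemma opEX (m : 'X_{1..k}) : opE 'X_[m] = \sum_i tauE (m i) *: 'X_[mset m i (m i).-1].
Proof.
apply: eq_bigr => i _; rewrite (_ : mset m i (m i).-1 = m - U_(i))%MM; last first.
  by apply/mnmP=> l; rewrite !mnmE eq_sym; case: eqP => [->|]; rewrite ?subn1 ?subn0.
rewrite mderivX mderivZ.
rewrite (_ : 'X_i * _ = ((m i)%:R * ((m i).-1)%:R) *: 'X_[m - U_(i)]).
  case: (m i) => [|b]; rewrite /tauE -!mul_mpolyC /=; first by ring.
  by rewrite -natr1; ring.
rewrite -scalerAr -scalerA; congr (_ *: _).
apply/mpolyP=> m'; rewrite mcoeff_mulX_mderiv mcoeffZ mcoeffX mulr_natl.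
by case: eqP => [<-|]; rewrite ?mul0rn // mnmBE mnm1E eqxx subn1.
Qed.

Lemma mul_evec (X : 'M[C]_n) m (lt_mn : (m < n)%N) a :
  (X *m evec C n m) a 0 = X a (Ordinal lt_mn).
Proof.
rewrite mxE (bigD1 (Ordinal lt_mn)) //= big1 ?addr0 => [|b ne_b].
  by rewrite mxE eqxx mulr1.
rewrite mxE; have /negbTE-> : b != m :> nat by [].
by rewrite mulr0.
Qed.

Lemma sum_nat_pick (s t j0 : nat) (F : nat -> C) :
    (forall j, (s <= j < t)%N -> j != j0 -> F j = 0) ->
  \sum_(s <= j < t) F j = if (s <= j0 < t)%N then F j0 else 0.
Proof.
move=> F0; transitivity (\sum_(s <= j < t | j == j0) F j); last exact: big_nat1_eq.
by rewrite [RHS]big_mkcond; apply: eq_big_nat => j lt_j; case: eqP => // /eqP; apply: F0.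
Qed.

(** For [m = n - 1] both sides vanish: [evec C n n] is the zero column. *)
Lemma dynkin_f_evec m : (m < n)%N -> dynkin_f C n *m evec C n m = 1 *: evec C n m.+1.
Proof.
move=> lt_mn; apply/colP=> a; rewrite mul_evec scale1r mxE /dynkin_f summxE.
rewrite (sum_nat_pick (j0 := m.+1)) => [|j /andP[j0 _] /negbTE ne_j]; rewrite mxE /=.
  rewrite eqxx andbT; case: ltnP => // le_nm.
  by rewrite (ltn_eqF (leq_trans (ltn_ord a) le_nm)).
by case: j j0 ne_j => //= j _; rewrite eqSS eq_sym => ->; rewrite andbF.
Qed.

Lemma dynkin_h_evec m : (m < n)%N -> dynkin_h C n *m evec C n m = tauH m *: evec C n m.
Proof.
move=> lt_mn; apply/colP=> a; rewrite mul_evec !mxE /dynkin_h summxE.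
rewrite (sum_nat_pick (j0 := m)) => [|j _ /negbTE ne_j]; rewrite !mxE /=.
  by rewrite lt_mn eqxx andbT.
by rewrite [m == j]eq_sym ne_j andbF mulr0.
Qed.

(** At [m = 0], where [m.-1] is 0 again, the factor [tauE 0] vanishes. *)
Lemma dynkin_e_evec m : (m < n)%N -> dynkin_e C n *m evec C n m = tauE m *: evec C n m.-1.
Proof.
move=> lt_mn; apply/colP=> a; rewrite mul_evec !mxE /dynkin_e summxE.
rewrite (sum_nat_pick (j0 := m)) => [|j _ /negbTE ne_j]; rewrite !mxE /=.
  rewrite lt_mn eqxx !andbT /tauE; case: ifP => // /negbT; rewrite -eqn0Ngt.
  by move/eqP->; rewrite !mul0r.
by rewrite [m == j]eq_sym ne_j andbF mulr0.
Qed.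

(** Lowering [x ^ n] is the only way out of the ideal (x^n), and its coefficient is 0. *)
Lemma tauE_ge m : (n <= m)%N -> tauE m = 0 \/ (n <= m.-1)%N.
Proof.
rewrite leq_eqVlt => /orP[/eqP<-|lt_nm]; first by left; rewrite /tauE subrr mulr0.
by right; case: m lt_nm.
Qed.

Local Notation delta := (fun j : 'I_k => (k - j.+1)%N).
Local Notation adelta := (alternant C delta).

(** The constant term of the formula for H is the weight of the class 1, the sum of the n-1-2m over
    m < k. *)
Lemma opH_adelta : opH adelta = (k%:R * (n%:R - k%:R)) *: adelta.
Proof.
rewrite (monop_alternant (sh := id) opHX).
rewrite (eq_bigr (fun j : 'I_k => tauH (k - j.+1)%N *: adelta)) => [|j _]; last first.
  by congr (_ *: _); apply: eq_alternant => l; rewrite /upd; case: eqP => // ->.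
rewrite -scaler_suml; congr (_ *: _).
by rewrite /tauH sumrB sumr_const card_ord -mulr_sumr sum_staircase; ring.
Qed.

Lemma opH_mul g a : opH (g * a) = g * opH a - 2 *: (a * euler g).
Proof.
rewrite /opH /euler !mulr_sumr scaler_sumr -sumrB; apply: eq_bigr => i _.
by rewrite mderivM -!mul_mpolyC; ring.
Qed.

(* A lowered column of the staircase collides with the next one, or is killed by [tauE 0 = 0]. *)
Lemma lower_staircase (alpha : 'I_k -> nat) (j : 'I_k) :
    alpha j = (k - j.+1)%N -> (forall l : 'I_k, l = j.+1 :> nat -> alpha l = (k - l.+1)%N) ->
  tauE (alpha j) *: alternant C (upd alpha j (alpha j).-1) = 0.
Proof.
move=> aj aSj; have [lt_jk|le_kj] := ltnP j.+1 k.
  rewrite (@alternant_eq _ _ _ j (Ordinal lt_jk)) ?scaler0 //.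
    by apply/eqP=> /(congr1 val) /= eq_j; have := ltnn j; rewrite {2}eq_j ltnSn.
  rewrite /upd eqxx aj (_ : _ == j = false) ?(aSj (Ordinal lt_jk)) //=; first by lia.
  by apply/negbTE/eqP=> /(congr1 val) /= eq_j; have := ltnn j; rewrite -{2}eq_j ltnSn.
by rewrite aj (_ : k - j.+1 = 0)%N ?/tauE ?mul0r ?scale0r //; lia.
Qed.

(** [adelta] corresponds to the highest weight vector, the wedge of the first [k] basis vectors. *)
Lemma opE_adelta : opE adelta = 0.
Proof.
rewrite (monop_alternant opEX) big1 // => j _.
by rewrite (@lower_staircase (fun j : 'I_k => (k - j.+1)%N)).
Qed.

Lemma upd_upd (alpha : 'I_k -> nat) j u v : upd (upd alpha j u) j v =1 upd alpha j v.
Proof. by move=> l; rewrite /upd; case: eqP. Qed.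

Lemma alternant_set (j0 : 'I_k) a :
  alternant C (upd delta j0 a) = monred k (sesym k C) a (k - j0.+1) * adelta.
Proof.
have k0 : (0 < k)%N := leq_ltn_trans (leq0n _) (ltn_ord j0).
by rewrite /alternant (alternant_schurred C _ k0) (schurred_staircase_set _ j0).
Qed.

(** The first entry of the staircase is [k.-1], so this is the bialternant formula for a one-row
    partition. *)
Lemma hsym_adelta l (k0 : (0 < k)%N) :
  hsym k C l * adelta = alternant C (upd delta (Ordinal k0) (l + k.-1)).
Proof. by rewrite alternant_set subn1. Qed.

(** Sorting moves the entry [k] past [j0] others and gives the exponents of a column of height
    [j0.+1]; with the sign inside [sesym] a single minus remains. *)
Lemma sesym_adelta (j0 : 'I_k) :
  sesym k C j0.+1 * adelta = - alternant C (upd delta j0 k).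
Proof.
rewrite alternant_set monred_k ?sesym0 ?mulNr ?opprK ?subKn ?ltn_ord //.
by have := ltn_ord j0; lia.
Qed.

Lemma hsym_adelta_vanish l : (0 < k)%N -> (n < l + k)%N -> vanish n (hsym k C l * adelta).
Proof.
move=> k0 lt_n; rewrite (hsym_adelta _ k0).
by apply: (@vanish_alternant _ _ _ _ (Ordinal k0)); rewrite /upd eqxx; lia.
Qed.

(** Only the raised first exponent [l + k] can be lowered without a collision. *)
Lemma opE_hsym l : (0 < k)%N ->
  opE (hsym k C l.+1 * adelta) = tauE (l + k) *: (hsym k C l * adelta).
Proof.
move=> k0; rewrite !(hsym_adelta _ k0) (monop_alternant opEX) (bigD1 (Ordinal k0)) //=.
rewrite big1 ?addr0 => [|j ne_j0].
  rewrite {1 3}/upd eqxx (_ : l.+1 + k.-1 = l + k)%N; last by lia.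
  congr (_ *: _); apply: eq_alternant => i; rewrite upd_upd /upd.
  by case: eqP => // _; lia.
apply: lower_staircase => [|i eq_i]; rewrite /upd ?(negbTE ne_j0) //.
by case: eqP eq_i => // ->.
Qed.

(* Raising to [k] the entry [k - j.+1] of [delta] leaves [k - j] as the only exponent that
   [opE] can lower without a collision. *)
Lemma opE_sesym j : (j < k)%N ->
  opE (sesym k C j.+1 * adelta) = - tauE (k - j) *: (sesym k C j * adelta).
Proof.
(* For [j = 0] the raised entry [k] is the first one, and it is the one that gets lowered. *)
case: j => [|j] lt_jk.
  rewrite (sesym_adelta (Ordinal lt_jk)) raddfN /= (monop_alternant opEX).
  rewrite (bigD1 (Ordinal lt_jk)) //= big1 ?addr0 => [|i ne_i].
    rewrite subn0 scaleNr sesym0 mul1r {1 3}/upd eqxx; congr (- (_ *: _)).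
    apply: eq_alternant => i; rewrite upd_upd /upd.
    by case: eqP => // ->; rewrite subn1.
  apply: lower_staircase => [|l eq_l]; rewrite /upd ?(negbTE ne_i) //.
  by case: eqP eq_l => // ->.
have lt_jk' := ltnW lt_jk; set j1 := Ordinal lt_jk; set j0 := Ordinal lt_jk'.
rewrite (sesym_adelta j1) (sesym_adelta j0) raddfN /= (monop_alternant opEX).
have ne_j01 : j0 != j1 by apply/eqP=> /(congr1 val) /= /eqP; rewrite ltn_eqF.
rewrite (bigD1 j0) // (bigD1 j1) 1?eq_sym // big1 => [|i]; last first.
  move=> /andP[ne_i0 ne_i1]; apply: lower_staircase => [|l eq_l]; rewrite /upd ?(negbTE ne_i1) //.
  case: eqP eq_l => // -> /= eq_l; case/eqP: ne_i0; apply/val_inj => /=; lia.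
(* Lowering the raised entry [k] to [k - 1] collides with the first entry of the staircase. *)
rewrite /= addr0 [X in _ + X](_ : _ = 0) ?addr0; last first.
  have k0 : (0 < k)%N := leq_ltn_trans (leq0n _) lt_jk.
  rewrite (@alternant_eq _ _ _ j1 (Ordinal k0)) ?scaler0 //.
  by rewrite /upd !eqxx /= subn1.
have -> : upd delta j1 k j0 = (k - j.+1)%N by rewrite /upd (negbTE ne_j01).
rewrite scaleNr scalerN opprK -scalerN; congr (_ *: _).
apply/eqP; rewrite eqr_oppLR -scaleN1r; apply/eqP.
(* The remaining exponents are those of [upd delta j0 k] with places [j0] and [j1] exchanged; -1 is
   rewritten as the sign of this transposition. *)
rewrite -[-1]expr1 -[1%N]/(true : nat) -{1}ne_j01 -odd_tperm -alternant_perm.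
apply: eq_alternant => i; rewrite /upd.
case: tpermP => [->|->|/eqP ne_i0 /eqP ne_i1].
- by rewrite eqxx eq_sym (negbTE ne_j01) /=; lia.
- by rewrite eqxx eq_sym (negbTE ne_j01) eqxx.
- by rewrite (negbTE ne_i0) (negbTE ne_i1).
Qed.

End Operators.

(** * Substitution of symmetric polynomials for the variables p_j and q_l *)

Lemma mpoly_ring_ind (R : nzRingType) m (P : {mpoly R[m]} -> Prop) :
    (forall c, P c%:MP) -> (forall i, P 'X_i) ->
    (forall f g, P f -> P g -> P (f + g)) ->
    (forall f g, P f -> P g -> P (f * g)) ->
  forall f, P f.
Proof.
move=> PC PX PD PM f; rewrite [f]mpolyE; apply: big_ind => //.
  by rewrite -mpolyC0; apply: PC.
move=> mm _; rewrite -mul_mpolyC; apply: (PM) => //; rewrite mpolyXE_id.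
apply: big_ind => //; first by rewrite -mpolyC1; apply: PC.
move=> i _; elim: (mm i) => [|e IHe]; first by rewrite expr0 -mpolyC1; apply: PC.
by rewrite exprS; apply: PM.
Qed.

Section ChainRule.
Variables (R : comNzRingType) (m k : nat) (t : m.-tuple {mpoly R[k]}).
Implicit Types (f : {mpoly R[m]}) (i : 'I_k).

Lemma mderiv_comp f i :
  (f \mPo t)^`M(i) = \sum_v (f^`M(v) \mPo t) * (tnth t v)^`M(i).
Proof.
elim/mpoly_ring_ind: f => [c|v|f g IHf IHg|f g IHf IHg].
- by rewrite comp_mpolyC mderivC big1 // => v _; rewrite mderivC comp_mpoly0 mul0r.
- rewrite comp_mpolyXU -tnth_nth (bigD1 v) //= big1 ?addr0 => [|u ne_u].
    rewrite mderivX mnm1E eqxx scale1r (_ : (U_(v) - U_(v))%MM = 0%MM).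
      by rewrite mpolyX0 comp_mpoly1 mul1r.
    by apply/mnmP=> l; rewrite mnmBE subnn mnm0E.
  by rewrite mderivX mnm1E eq_sym (negbTE ne_u) scale0r comp_mpoly0 mul0r.
- rewrite comp_mpolyD mderivD IHf IHg -big_split; apply: eq_bigr => v _ /=.
  by rewrite mderivD comp_mpolyD mulrDl.
- rewrite rmorphM mderivM IHf IHg mulr_suml mulr_sumr -big_split.
  by apply: eq_bigr => v _ /=; rewrite mderivM comp_mpolyD !rmorphM /=; ring.
Qed.

End ChainRule.

Section Evaluation.
Variables (C : fieldType) (k n : nat).
Hypothesis k0 : (0 < k)%N.
Local Notation S := {mpoly C[k]}.
Local Notation sesym := (sesym k C).
Local Notation hsym := (hsym k C).
Local Notation adelta := (alternant C (fun j : 'I_k => (k - j.+1)%N)).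
Implicit Types (f : pq_poly C k n).

Definition pq_roots : (k + (n - k)).-tuple S :=
  [tuple match split v with inl i => sesym i.+1 | inr i => hsym i.+1 end | v < k + (n - k)].

Definition pq_sym f : S := f \mPo pq_roots.

Local Notation phi := pq_sym.
HB.instance Definition _ := GRing.RMorphism.copy phi (comp_mpoly pq_roots).
HB.instance Definition _ := GRing.Linear.copy phi (comp_mpoly pq_roots).

Lemma tnth_lroots (i : 'I_k) : tnth pq_roots (lshift (n - k) i) = sesym i.+1.
Proof. by rewrite tnth_mktuple (unsplitK (inl i)). Qed.

Lemma tnth_rroots (i : 'I_(n - k)) : tnth pq_roots (rshift k i) = hsym i.+1.
Proof. by rewrite tnth_mktuple (unsplitK (inr i)). Qed.

Lemma phi_pvar j : phi (pvar C k n j) = sesym j.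
Proof.
case: j => [|j]; first by rewrite /pq_sym rmorph1 sesym0.
rewrite /pvar; case: insubP => [i _ <-|]; rewrite /pq_sym.
  by rewrite comp_mpolyXU -tnth_nth tnth_lroots.
by rewrite -ltnNge ltnS => lt_kj; rewrite raddf0 sesym_gt.
Qed.

(** q_l is 0 for l > n - k, while h_l is not; the two agree only after multiplication by [adelta],
    modulo the ideal. *)
Definition hsym_trunc l : S := if (l <= n - k)%N then hsym l else 0.

Lemma phi_qvar l : phi (qvar C k n l) = hsym_trunc l.
Proof.
rewrite /hsym_trunc; case: l => [|l]; first by rewrite /pq_sym rmorph1 hsym0.
rewrite /qvar; case: insubP => [i lt_i <-|]; rewrite /pq_sym.
  by rewrite comp_mpolyXU -tnth_nth tnth_rroots ltn_ord.
by move/negbTE->; rewrite raddf0.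
Qed.

Lemma hsym_trunc_vanish (g : S) l : (k <= n)%N ->
  vanish n (g * ((hsym l - hsym_trunc l) * adelta)).
Proof.
move=> le_kn; apply: vanishMl; rewrite /hsym_trunc; case: leqP => [_|lt_l].
  by rewrite subrr mul0r; apply: vanish0.
by rewrite subr0; apply: hsym_adelta_vanish => //; lia.
Qed.

(** As [opE] kills [adelta], the operator g |-> opE (g adelta) has no term of order zero. Its values
    on the generators account for the first derivatives of [f], and the symbol for the second
    ones. *)
Lemma opE_phi f : opE n (phi f * adelta) =
  \sum_v phi f^`M(v) * opE n (tnth pq_roots v * adelta)
  - adelta * \sum_u \sum_v phi (f^`M(v)^`M(u)) * symbol (tnth pq_roots u) (tnth pq_roots v).
Proof.
move: (@opE_adelta C k n); move: (alternant C _) => a a0.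
(* The product rule for [opE n (g * a)], without the zero term [g * opE n a]. *)
pose L g := \sum_i ((n%:R - 1) *: (a * g^`M(i)) - 'X_i * a * g^`M(i)^`M(i)
   - 2 *: ('X_i * a^`M(i) * g^`M(i))).
have opE_L g : opE n (g * a) = L g.
  have -> : L g = L g + g * opE n a by rewrite a0 mulr0 addr0.
  rewrite /opE /L mulr_sumr -big_split; apply: eq_bigr => i _ /=.
  by rewrite !(mderivD, mderivM) -!mul_mpolyC; ring.
rewrite opE_L; under [X in _ = X - _]eq_bigr do rewrite opE_L /L mulr_sumr.
rewrite exchange_big mulr_sumr.
under [X in _ = _ - X]eq_bigr do rewrite mulr_sumr.
under [X in _ = _ - X]eq_bigr do under eq_bigr do rewrite /symbol !mulr_sumr.
under [X in _ = _ - X]eq_bigr do rewrite exchange_big.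
rewrite [X in _ = _ - X]exchange_big -sumrB; apply: eq_bigr => i _ /=.
have dphi g : (phi g)^`M(i) = \sum_v phi g^`M(v) * (tnth pq_roots v)^`M(i) by exact: mderiv_comp.
set D := \sum_v phi f^`M(v) * (tnth pq_roots v)^`M(i).
(* The chain rule applied twice: [B] produces the symbol, [DD] belongs to the values on the
   generators. *)
pose B := \sum_u \sum_v phi (f^`M(v)^`M(u)) * ((tnth pq_roots u)^`M(i) * (tnth pq_roots v)^`M(i)).
pose DD := \sum_v phi f^`M(v) * (tnth pq_roots v)^`M(i)^`M(i).
have -> : (phi f)^`M(i)^`M(i) = B + DD.
  rewrite dphi raddf_sum /B exchange_big -big_split; apply: eq_bigr => v _ /=.
  by rewrite mderivM dphi mulr_suml; congr (_ + _); apply: eq_bigr => u _; rewrite mulrA.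
rewrite [X in _ = X - _](_ : _ = (n%:R - 1) *: (a * D) - 'X_i * a * DD
    - 2 *: ('X_i * a^`M(i) * D)); last first.
  rewrite !mulr_sumr !scaler_sumr -!sumrB; apply: eq_bigr => v _.
  by rewrite -!mul_mpolyC; ring.
rewrite [X in _ = _ - X](_ : _ = 'X_i * a * B).
  by rewrite dphi -/D -!mul_mpolyC; ring.
rewrite mulr_sumr; apply: eq_bigr => u _; rewrite mulr_sumr.
by apply: eq_bigr => v _; ring.
Qed.

End Evaluation.

(** * Comparison of the differential operators with those on antisymmetric polynomials *)

Section DiffOps.
Variables (C : fieldType) (k n : nat).
Hypotheses (k0 : (0 < k)%N) (le_kn : (k <= n)%N).
Local Notation S := {mpoly C[k]}.
Local Notation P := (sesym k C).
Local Notation H := (hsym k C).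
Local Notation Q := (hsym_trunc C k n).
Local Notation adelta := (alternant C (fun j : 'I_k => (k - j.+1)%N)).
Local Notation phi := (@pq_sym C k n).
Implicit Types (f : pq_poly C k n).

Lemma phiZ c f : phi (c *: f) = c%:MP * phi f.
Proof. by rewrite /pq_sym comp_mpolyZ mul_mpolyC. Qed.

Lemma phiD f g : phi (f + g) = phi f + phi g.
Proof. exact: raddfD. Qed.

Lemma phiM f g : phi (f * g) = phi f * phi g.
Proof. exact: rmorphM. Qed.

Lemma phiN f : phi (- f) = - phi f.
Proof. exact: raddfN. Qed.

Lemma phi_sum I (r : seq I) (F : I -> pq_poly C k n) :
  phi (\sum_(x <- r) F x) = \sum_(x <- r) phi (F x).
Proof. exact: raddf_sum. Qed.

Lemma phi_diffF f : phi (diffF f) * adelta = opF (phi f * adelta).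
Proof.
rewrite /diffF /opF rmorphM rmorphN /= phi_pvar /sesym mesym1E expr1 scaleN1r opprK.
by rewrite mulrA.
Qed.

Lemma phi_euler f : euler (phi f) =
  \sum_(i < k) i.+1%:R * (phi (pvar C k n i.+1) * phi (dp i f))
  + \sum_(i < n - k) i.+1%:R * (phi (qvar C k n i.+1) * phi (dq i f)).
Proof.
rewrite /euler; under eq_bigr do rewrite [(phi f)^`M(_)]mderiv_comp mulr_sumr.
rewrite exchange_big big_split_ord /=; congr (_ + _); apply: eq_bigr => i _.
  under eq_bigr do rewrite mulrCA.
  rewrite -mulr_sumr tnth_lroots -/(euler _) euler_sesym phi_pvar mulrnAr mulr_natl.
  by congr (_ *+ _); apply: mulrC.
under eq_bigr do rewrite mulrCA.
rewrite -mulr_sumr tnth_rroots -/(euler _) euler_hsym // phi_qvar // /hsym_trunc ltn_ord.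
by rewrite mulrnAr mulr_natl; congr (_ *+ _); apply: mulrC.
Qed.

Lemma phi_diffH f : phi (diffH f) * adelta = opH n (phi f * adelta).
Proof.
rewrite opH_mul opH_adelta phi_euler; move: (alternant C _) => a.
rewrite /diffH 2!raddfD raddfN /= 3!phiZ !raddf_sum /=.
under eq_bigr do rewrite phiZ rmorphM /= mpolyC_nat.
under [X in _ - _ * X]eq_bigr do rewrite phiZ rmorphM /= mpolyC_nat.
by rewrite -!mul_mpolyC; ring.
Qed.

Lemma mpolyC_coef (j l d : nat) :
  (j%:R + l%:R - 2 * d%:R - 1 : C)%:MP = j%:R + l%:R - 2 * d%:R - 1 :> S.
Proof. by rewrite !rmorphB !rmorphD rmorphM !rmorph_nat rmorph1. Qed.

(** In the sums over q, [d <= i < n - k], so that q_d becomes exactly h_d; only the factor of index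
    [i.+1 + i'.+1 - d - 1] may need truncation. *)
Lemma phi_diffE_sum f : phi (diffE f) =
  - (\sum_(i < k) (tauE C n (k - i))%:MP * (P i * phi (dp i f)))
  + \sum_(i < n - k) (tauE C n (i + k))%:MP * (H i * phi (dq i f))
  - \sum_(i < k) \sum_(i' < k) symbol (P i.+1) (P i'.+1) * phi (dp i (dp i' f))
  - \sum_(i < n - k) \sum_(i' < n - k)
      (\sum_(d < i.+1) (i.+1%:R + i'.+1%:R - 2 * d%:R - 1)
         * (H d * Q (i.+1 + i'.+1 - d - 1)%N)) * phi (dq i (dq i' f))
  + 2 * \sum_(i < k) \sum_(i' < n - k) (i.+1%:R + i'.+1%:R - 1)
      * ((\sum_(d < i.+1) P d * Q (i.+1 + i'.+1 - d - 1)%N) * phi (dp i (dq i' f))).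
Proof.
rewrite /diffE 4!phiD 2!phiN phiZ mpolyC_nat !phi_sum.
congr (_ + _); [congr (_ - _); [congr (_ + _); [congr (- _ + _)|]|]|congr (_ * _)].
- apply: eq_bigr => i _; rewrite phiZ phiM /= phi_pvar subn1 /=; congr (_%:MP * _).
  by rewrite /tauE natrB ?(ltnW (ltn_ord i)) // -!natr1; ring.
- apply: eq_bigr => i _; rewrite phiZ phiM /= phi_qvar // subn1 /hsym_trunc ltnW ?ltn_ord //.
  by congr (_%:MP * _); rewrite /tauE natrD -!natr1; ring.
- rewrite -sumrN; apply: eq_bigr => i _; rewrite phi_sum -sumrN; apply: eq_bigr => i' _.
  rewrite phiM symbol_sesym mulNr opprK /= phi_sum; congr (_ * _); apply: eq_bigr => d _.
  by rewrite phiZ mpolyC_coef phiM /= !phi_pvar.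
- apply: eq_bigr => i _; rewrite phi_sum; apply: eq_bigr => i' _.
  rewrite phiM /= phi_sum; congr (_ * _); apply: eq_bigr => d _.
  rewrite phiZ mpolyC_coef phiM /= !phi_qvar //; congr (_ * (_ * _)).
  by rewrite /hsym_trunc (leq_trans (ltnW (ltn_ord d)) (ltn_ord i)).
- apply: eq_bigr => i _; rewrite phi_sum; apply: eq_bigr => i' _.
  rewrite phiZ phiM /= phi_sum rmorphB rmorphD !rmorph_nat rmorph1; congr (_ * (_ * _)).
  by apply: eq_bigr => d _; rewrite phiM /= phi_pvar phi_qvar.
Qed.

Lemma symbolC (g h : S) : symbol g h = symbol h g.
Proof. by apply: eq_bigr => i _; congr (_ * _); apply: mulrC. Qed.

Lemma opE_phi_sum f : opE n (phi f * adelta) =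
  (- (\sum_(i < k) (tauE C n (k - i))%:MP * (P i * phi (dp i f)))
  + \sum_(i < n - k) (tauE C n (i + k))%:MP * (H i * phi (dq i f))
  - \sum_(i < k) \sum_(i' < k) symbol (P i.+1) (P i'.+1) * phi (dp i (dp i' f))
  - \sum_(i < n - k) \sum_(i' < n - k) symbol (H i.+1) (H i'.+1) * phi (dq i (dq i' f))
  - 2 * \sum_(i < k) \sum_(i' < n - k) symbol (P i.+1) (H i'.+1) * phi (dp i (dq i' f)))
  * adelta.
Proof.
rewrite opE_phi // big_split_ord /=.
under eq_bigr do rewrite tnth_lroots opE_sesym ?ltn_ord // -mul_mpolyC mpolyCN.
under [X in _ + X - _]eq_bigr do rewrite tnth_rroots opE_hsym // -mul_mpolyC.
set B := (X in _ - _ * X).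
have -> : B =
    \sum_(i < k) \sum_(i' < k) symbol (P i.+1) (P i'.+1) * phi (dp i (dp i' f))
  + \sum_(i < n - k) \sum_(i' < n - k) symbol (H i.+1) (H i'.+1) * phi (dq i (dq i' f))
  + 2 * \sum_(i < k) \sum_(i' < n - k) symbol (P i.+1) (H i'.+1) * phi (dp i (dq i' f)).
  rewrite /B big_split_ord /=.
  under eq_bigr do rewrite big_split_ord /=.
  under [X in _ + X]eq_bigr do rewrite big_split_ord /=.
  (* The two mixed sums agree by symmetry of [symbol] and of second derivatives, whence the factor
     2. *)
  rewrite !big_split /= [X in _ + (X + _)]exchange_big /= mulr_natl mulr2n.
  rewrite -addrA [X in _ + X]addrCA addrA [RHS]addrAC -!addrA.
  congr (_ + _); [|congr (_ + _); [|congr (_ + _)]]; apply: eq_bigr => i _;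
    apply: eq_bigr => i' _; rewrite ?tnth_lroots ?tnth_rroots; try exact: mulrC.
  by rewrite mderiv_comm symbolC mulrC.
move: (alternant C _) => a.
rewrite [X in X + _ - _](_ : _ =
    - (\sum_(i < k) (tauE C n (k - i))%:MP * (P i * phi (dp i f))) * a); last first.
  by rewrite mulNr mulr_suml -sumrN; apply: eq_bigr => i _; rewrite /dp; ring.
rewrite [X in _ + X - _](_ : _ =
    (\sum_(i < n - k) (tauE C n (i + k))%:MP * (H i * phi (dq i f))) * a); last first.
  by rewrite mulr_suml; apply: eq_bigr => i _; rewrite /dq; ring.
by ring.
Qed.

Lemma phi_diffE f :
  vanish n (phi (diffE f) * adelta - opE n (phi f * adelta)).
Proof.
rewrite phi_diffE_sum opE_phi_sum.
(* Only the second-order sums involving q differ, each by terms with a factor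
   [(H e - Q e) * adelta]. *)
have diff (T1 T2 T3 T4 T5 B4 B5 a : S) :
    (T1 + T2 - T3 - T4 + 2 * T5) * a - (T1 + T2 - T3 - B4 - 2 * B5) * a
  = (B4 - T4) * a + 2 * ((T5 + B5) * a) by ring.
rewrite diff => {diff}.
apply: vanishD; last apply: vanishMl.
  rewrite -sumrB mulr_suml; apply: vanish_sum => i _; rewrite -sumrB mulr_suml.
  apply: vanish_sum => i' _; rewrite symbol_hsym // -mulrBl -sumrB !mulr_suml.
  apply: vanish_sum => d _.
  set c := _ - 1; set e := (_ - 1)%N.
  rewrite [X in vanish n X](_ : _ =
    c * H d * phi (dq i (dq i' f)) * ((H e - Q e) * adelta)); last by ring.
  exact: hsym_trunc_vanish.
rewrite -big_split mulr_suml; apply: vanish_sum => i _; rewrite -big_split mulr_suml.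
apply: vanish_sum => i' _; rewrite symbol_sesym_hsym //=.
set c := _ - 1.
rewrite (_ : _ * adelta = - c * phi (dp i (dq i' f)) *
  \sum_(d < i.+1) P d * ((H (i.+1 + i'.+1 - d - 1)%N - Q (i.+1 + i'.+1 - d - 1)%N) * adelta)).
  apply: vanishMl; apply: vanish_sum => d _; exact: hsym_trunc_vanish.
under [in RHS]eq_bigr do rewrite mulrA mulrBr.
by rewrite -mulr_suml sumrB; ring.
Qed.

End DiffOps.

(** * The isomorphism with the exterior power *)

Section ToA.
Variables (C : fieldType) (k n : nat).

Lemma toA_is_zmod_morphism : zmod_morphism (@toA C k n).
Proof. by move=> f g; rewrite /toA !piE. Qed.
HB.instance Definition _ := GRing.isZmodMorphism.Build _ _ (@toA C k n) toA_is_zmod_morphism.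

Lemma toA_is_monoid_morphism : monoid_morphism (@toA C k n).
Proof. by split=> [|f g]; [apply: toA1 | apply: toAM]. Qed.
HB.instance Definition _ := GRing.isMonoidMorphism.Build _ _ (@toA C k n) toA_is_monoid_morphism.

Lemma toA_eq0 f : (@toA C k n f == 0) = (f \in relI C k n).
Proof.
by rewrite -(raddf0 (@toA C k n)) /toA /algA -Quotient.idealrBE subr0.
Qed.

Lemma toAZ c f : @toA C k n (c *: f) = c *: toA f.
Proof. by rewrite -mul_mpolyC toAM. Qed.

Lemma toA_relR m : (0 < m <= n)%N -> toA (relR C k n m) = 0.
Proof.
move=> m_range; apply/eqP; rewrite toA_eq0; apply/boolp.asboolP.
exists (fun j => (j == m)%:R).
rewrite (eq_bigr (fun j => if j == m then relR C k n j else 0)) => [|j _].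
  by rewrite -big_mkcond big_nat1_eq ltnS m_range.
by case: eqP; rewrite ?mul1r ?mul0r.
Qed.

End ToA.

Lemma comp_mpolyX_tnth (R : nzRingType) m k (t : m.-tuple {mpoly R[k]}) i :
  'X_i \mPo t = tnth t i.
Proof. by rewrite comp_mpolyXU -tnth_nth. Qed.

(** * Elimination of the q_l, and Schubert classes as determinants in A *)

Section Symmetric.
Variables (C : fieldType) (k n : nat).
Hypotheses (k0 : (0 < k)%N) (le_kn : (k <= n)%N).
Local Notation S := {mpoly C[k]}.
Local Notation A := (algA C k n).
Local Notation phi := (@pq_sym C k n).
Local Notation adelta := (alternant C (fun j : 'I_k => (k - j.+1)%N)).
Local Notation pA := (fun j => @toA C k n (pvar C k n j)).

(** Stands for p_j in a polynomial ring whose variables are formal e_1, ..., e_k. Evaluating these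
    at [mesyms] is injective; evaluating them at [pvars] leads to A. *)
Definition svar (j : nat) : S :=
  if j is j'.+1 then if insub j' is Some i then (-1) ^+ j *: 'X_i else 0 else 1.

Definition mesyms : k.-tuple S := [tuple mesym k C i.+1 | i < k].
Definition pvars : k.-tuple (pq_poly C k n) := [tuple (-1) ^+ i.+1 * pvar C k n i.+1 | i < k].

Definition svar_toA (F : S) : A := toA (F \mPo pvars).
Local Notation psi := svar_toA.
HB.instance Definition _ := GRing.RMorphism.copy psi (@toA C k n \o comp_mpoly pvars).

Lemma psiZ c F : psi (c *: F) = c *: psi F.
Proof. by rewrite /svar_toA comp_mpolyZ toAZ. Qed.

Lemma svar_mesyms j : svar j \mPo mesyms = sesym k C j.
Proof.
case: j => [|j]; first by rewrite rmorph1 sesym0.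
rewrite /svar; case: insubP => [i _ <-|].
  by rewrite comp_mpolyZ comp_mpolyX_tnth tnth_mktuple.
by rewrite -ltnNge ltnS => lt_kj; rewrite raddf0 sesym_gt.
Qed.

Lemma pA_gt j : (k < j)%N -> pA j = 0.
Proof.
case: j => // j lt_kj; rewrite /pvar insubF ?raddf0 //.
by apply/negbTE; rewrite -leqNgt -ltnS.
Qed.

Lemma psi_svar j : psi (svar j) = pA j.
Proof.
case: j => [|j]; first by rewrite rmorph1 toA1.
rewrite /svar /psi; case: insubP => [i _ <-|].
  rewrite comp_mpolyZ comp_mpolyX_tnth tnth_mktuple -mul_mpolyC rmorphXn rmorphN1.
  by rewrite mulrA -exprMn mulrNN mulr1 expr1n mul1r.
by rewrite -ltnNge => lt_kj; rewrite comp_mpoly0 raddf0 [RHS]pA_gt.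
Qed.

(** Eliminates q_l in favour of the formal e_j; [phi_mesyms] and [psi_pq_syms] show that neither the
    symmetric polynomial nor the class in A changes. *)
Definition pq_syms : (k + (n - k)).-tuple S :=
  [tuple match split v with inl i => svar i.+1 | inr i => hred k svar i.+1 end | v < k + (n - k)].

Lemma tnth_lsyms (i : 'I_k) : tnth pq_syms (lshift (n - k) i) = svar i.+1.
Proof. by rewrite tnth_mktuple (unsplitK (inl i)). Qed.

Lemma tnth_rsyms (i : 'I_(n - k)) : tnth pq_syms (rshift k i) = hred k svar i.+1.
Proof. by rewrite tnth_mktuple (unsplitK (inr i)). Qed.

Lemma phi_mesyms f : phi f = (f \mPo pq_syms) \mPo mesyms.
Proof.
elim/mpoly_ring_ind: f => [c|v|f g IHf IHg|f g IHf IHg].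
- by rewrite [_ \mPo pq_syms]comp_mpolyC [RHS]comp_mpolyC; apply: comp_mpolyC.
- rewrite [LHS]comp_mpolyX_tnth [_ \mPo pq_syms]comp_mpolyX_tnth; case: (split_ordP v) => i ->.
    by rewrite [LHS]tnth_lroots [tnth pq_syms _]tnth_lsyms [RHS]svar_mesyms.
  rewrite [LHS]tnth_rroots [tnth pq_syms _]tnth_rsyms [RHS]rmorph_hred.
  by apply: eq_hred => j; rewrite [RHS]svar_mesyms.
- by rewrite phiD IHf IHg !comp_mpolyD.
- by rewrite phiM IHf IHg !rmorphM.
Qed.

Lemma pA_conv m : \sum_(r < m.+1) pA r * hred k pA (m - r) = (m == 0)%:R.
Proof. by apply: hred_conv; [|apply: toA1|apply: pA_gt]. Qed.

(** The relations R_m and [pA_conv] are the same recursion, which determines its solution because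
    p_0 = 1. *)
Lemma hred_pA m : (m <= n)%N -> hred k pA m = toA (qvar C k n m).
Proof.
elim/ltn_ind: m => m IHm le_mn; have := pA_conv m.
rewrite big_ord_recl [(m - _)%N]subn0 [toA _]toA1 mul1r.
case: m IHm le_mn => [|m] IHm le_mn.
  by rewrite big_ord0 addr0 => ->; rewrite [RHS]toA1.
have : \sum_(r < m.+2) pA r * toA (qvar C k n (m.+1 - r)) = 0.
  rewrite -[RHS](@toA_relR C k n m.+1) // raddf_sum; apply: eq_bigr => r _.
  by rewrite [RHS]toAM.
move=> sum0 /eqP; rewrite addr_eq0 => /eqP->; apply/eqP.
rewrite eq_sym -subr_eq0 opprK -[X in _ == X]sum0 [X in _ == X]big_ord_recl.
rewrite [(m.+1 - @ord0 m.+1)%N]subn0 [X in _ == X * _ + _]toA1 mul1r; apply/eqP.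
by congr (_ + _); apply: eq_bigr => i _; rewrite IHm //= /bump; have := ltn_ord i; lia.
Qed.

(** Up to [n] this is q_l = 0. Beyond [n], since p_r = 0 for r > k, the recursion involves only the
    [k] preceding values, all of index above n - k. *)
Lemma hred_pA_eq0 l : (n < l + k)%N -> hred k pA l = 0.
Proof.
elim/ltn_ind: l => l IHl lt_n; have [le_ln|lt_nl] := leqP l n.
  rewrite hred_pA //; case: l {IHl} lt_n le_ln => [|l] lt_n le_ln.
    by rewrite ltnNge le_kn in lt_n.
  by rewrite /qvar insubF ?raddf0 //; apply/negbTE; rewrite -leqNgt; lia.
have := pA_conv l; rewrite big_ord_recl [(l - _)%N]subn0 [toA _]toA1 mul1r.
rewrite big1 ?addr0 => [->|r _].
  by rewrite gtn_eqF // (leq_ltn_trans _ lt_nl).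
have [le_rk|lt_kr] := leqP (lift ord0 r) k; last by rewrite pA_gt ?mul0r.
by rewrite IHl ?mulr0 //; move: le_rk; rewrite /= /bump /=; lia.
Qed.

Lemma psi_pq_syms f : psi (f \mPo pq_syms) = toA f.
Proof.
elim/mpoly_ring_ind: f => [c|v|f g IHf IHg|f g IHf IHg].
- by rewrite [_ \mPo pq_syms]comp_mpolyC /svar_toA [_ \mPo pvars]comp_mpolyC.
- rewrite comp_mpolyX_tnth; case: (split_ordP v) => i ->.
    rewrite tnth_lsyms psi_svar /pvar.
    by case: insubP => [j _ /val_inj->|]; rewrite // ltn_ord.
  rewrite tnth_rsyms rmorph_hred (eq_hred _ _ psi_svar) hred_pA; last by have := ltn_ord i; lia.
  by rewrite /qvar; case: insubP => [j _ /val_inj->|]; rewrite // ltn_ord.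
- by rewrite comp_mpolyD !raddfD /= IHf IHg.
- by rewrite !rmorphM /= IHf IHg.
Qed.

Lemma phi_pvars F : phi (F \mPo pvars) = F \mPo mesyms.
Proof.
elim/mpoly_ring_ind: F => [c|v|f g IHf IHg|f g IHf IHg].
- by rewrite [_ \mPo pvars]comp_mpolyC [RHS]comp_mpolyC; apply: comp_mpolyC.
- rewrite [_ \mPo pvars]comp_mpolyX_tnth [RHS]comp_mpolyX_tnth.
  rewrite [tnth pvars _]tnth_mktuple [RHS]tnth_mktuple.
  rewrite phiM phi_pvar /sesym -mul_mpolyC !rmorphXn !rmorphN1.
  by rewrite mulrA -exprMn mulrNN mulr1 expr1n mul1r.
- by rewrite [_ \mPo pvars]comp_mpolyD phiD [RHS]comp_mpolyD IHf IHg.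
- by rewrite [_ \mPo pvars]rmorphM phiM [RHS]rmorphM /= IHf IHg.
Qed.

Lemma mesyms_sym F : F \mPo mesyms \is symmetric.
Proof. by apply: mcomp_sym => i; rewrite -tnth_nth tnth_mktuple mesym_sym. Qed.

Lemma antisym_phi f : antisym (phi f * adelta).
Proof.
move=> s; rewrite msymM msym_alternant phi_mesyms.
by rewrite (issymP _ (mesyms_sym _)) scalerAr.
Qed.

Lemma schurred_mesyms (alpha : 'I_k -> nat) :
  (schurred svar alpha \mPo mesyms) * adelta = alternant C alpha.
Proof.
have -> : alternant C alpha = schurred (sesym k C) alpha * adelta by exact: alternant_schurred.
by congr (_ * _); rewrite [LHS]rmorph_schurred; apply: eq_schurred svar_mesyms.
Qed.

(** Every alternant is a multiple of [adelta], and some alternant has a coordinate equal to 1. *)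
Lemma adelta_neq0 : adelta != 0.
Proof.
have [a _] : exists (a : incr_seq k n) (s : 'S_k), forall i, seq_nat a i = s i.
  by apply: exists_incr_seq; [apply: val_inj | move=> i; apply: leq_trans le_kn].
apply/eqP=> d0; have := coords_basis C a a.
rewrite eqxx -schurred_mesyms d0 mulr0 raddf0 ffunE => /eqP.
by rewrite eq_sym oner_eq0.
Qed.

(** The quotient chosen in [schur] is pinned down because [adelta] can be cancelled, and [symf]
    because the e_j are algebraically independent. *)
Lemma schubertE (lam : 'I_k -> nat) :
  schubert C n lam = psi (schurred svar (fun j => (lam j + (k - j.+1))%N)).
Proof.
rewrite /schubert /sym_toA; congr (toA (_ \mPo _)); set F := schurred _ _.
suff -> : schur C lam = F \mPo mesyms.
  by apply: msym_fundamental_un; rewrite -symfP ?mesyms_sym.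
apply: (mulIf adelta_neq0); rewrite schurred_mesyms.
apply: (@classical_sets.xgetPex _ 0
  (fun s => s * adelta = alternant C (fun j => (lam j + (k - j.+1))%N))).
by exists (F \mPo mesyms); apply: schurred_mesyms.
Qed.

End Symmetric.

(** * Construction and uniqueness of the isomorphism, and the transported operators *)

Lemma schurred_perm (R : comNzRingType) k (p : nat -> R) (alpha : 'I_k -> nat) (s : 'S_k) :
  schurred p (fun j => alpha (s j)) = (-1) ^+ s * schurred p alpha.
Proof.
rewrite /schurred -odd_permV -det_perm mulrC -det_mulmx -col_permE.
by congr (\det _); apply/matrixP=> i j; rewrite !mxE.
Qed.

Section Iso.
Variables (C : fieldType) (k n : nat).
Hypotheses (char0 : [pchar C] =i pred0) (k0 : (0 < k)%N) (le_kn : (k <= n)%N).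
Local Notation S := {mpoly C[k]}.
Local Notation A := (algA C k n).
Local Notation phi := (@pq_sym C k n).
Local Notation adelta := (alternant C (fun j : 'I_k => (k - j.+1)%N)).
Local Notation svar := (svar C k).
Local Notation psi := (@svar_toA C k n).

(** For m > 0 the convolution of [sesym] and [hsym] is 0, so the image of R_m is only a truncation
    defect. *)
Lemma vanish_relI f : f \in relI C k n -> vanish n (phi f * adelta).
Proof.
move=> /boolp.asboolP[g ->]; rewrite phi_sum mulr_suml big_nat_cond.
apply: vanish_sum => m /andP[/andP[m0 _] _].
rewrite phiM -mulrA; apply: vanishMl.
have -> : phi (relR C k n m) =
    - \sum_(r < m.+1) sesym k C r * (hsym k C (m - r) - hsym_trunc C k n (m - r)).
  under eq_bigr do rewrite mulrBr.
  rewrite sumrB hsym_conv // -[(_ == _)%:R]/((m == 0)%:R) gtn_eqF // sub0r opprK phi_sum.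
  by apply: eq_bigr => r _; rewrite phiM phi_pvar phi_qvar.
rewrite mulNr mulr_suml; apply/vanishN/vanish_sum => r _.
by rewrite -mulrA; apply: hsym_trunc_vanish.
Qed.

(* The antisymmetrization formula of [antisym_sum], divided by [a_delta]. *)
Lemma vanish_toA f : vanish n (phi f * adelta) -> toA f = 0.
Proof.
move=> van; have asum := antisym_sum (antisym_phi f).
set g := phi f * adelta in van asum; set F := f \mPo pq_syms C k n.
(* Cancelling [adelta] and using algebraic independence lifts the formula to the formal e_j, from
   where it can be sent to A. *)
have : k`!%:R *: F = \sum_(m <- msupp g) g@_m *: schurred svar m.
  apply: msym_fundamental_un; apply: (mulIf (adelta_neq0 C k0 le_kn)).
  rewrite comp_mpolyZ -phi_mesyms // -scalerAl asum raddf_sum mulr_suml.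
  by apply: eq_bigr => m _; rewrite /= comp_mpolyZ -scalerAl schurred_mesyms.
move/(congr1 psi); rewrite psiZ psi_pq_syms // raddf_sum big1 /= => [|m _].
  move/eqP; rewrite scaler_eq0; move/pcharf0P: char0 => ->.
  by rewrite (gtn_eqF (fact_gt0 k)) => /eqP.
(* If all exponents are below [n] the coefficient is 0 by [van]; otherwise the Schur determinant is
   0 in A. *)
have [/forallP lt_m|] := boolP [forall i : 'I_k, m i < n]%N.
  by rewrite van // scale0r raddf0.
case/forallPn => i; rewrite -leqNgt => le_nm.
rewrite psiZ rmorph_schurred (@schurred_eq0 _ _ _ n _ i) ?scaler0 // => l lt_n.
by rewrite (eq_hred _ _ (@psi_svar C k n)) hred_pA_eq0.
Qed.

Definition theta0 f : ext_power C k n := coords n (phi f * adelta).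

Lemma theta0_is_linear : linear theta0.
Proof.
by move=> c f g; rewrite /theta0 phiD phiZ mul_mpolyC mulrDl -scalerAl linearD linearZ.
Qed.
HB.instance Definition _ := GRing.isLinear.Build C (pq_poly C k n) (ext_power C k n) _ theta0
  theta0_is_linear.

Lemma theta0_eq0 f : theta0 f = 0 <-> toA f = 0.
Proof.
split=> [th0|/eqP]; first by apply/vanish_toA/antisym_vanish => //; apply: antisym_phi.
by rewrite toA_eq0 => /vanish_relI/vanish_coords.
Qed.

Definition theta (x : A) : ext_power C k n := theta0 (generic_quotient.repr x).

Lemma theta_toA f : theta (toA f) = theta0 f.
Proof.
apply/eqP; rewrite -subr_eq0 -raddfB /=; apply/eqP/theta0_eq0.
by rewrite raddfB /= [X in X - _]reprK subrr.
Qed.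

Lemma toA_surj (x : A) : exists f, x = toA f.
Proof. by exists (generic_quotient.repr x); rewrite [RHS]reprK. Qed.

Lemma theta_is_linear : linear theta.
Proof.
move=> c x y; have [[f ->] [g ->]] := (toA_surj x, toA_surj y).
by rewrite -toAZ -toAD !theta_toA linearP.
Qed.
HB.instance Definition _ := GRing.isLinear.Build C A (ext_power C k n) _ theta theta_is_linear.

(* The linear structure of [theta] depends on the hypotheses of the section, so that it is not
   inferred outside. *)
Definition linear_theta : {linear A -> ext_power C k n} := theta.

Lemma theta_inj : injective theta.
Proof.
move=> x y; have [[f ->] [g ->]] := (toA_surj x, toA_surj y); rewrite !theta_toA => eq_fg.
apply/eqP; rewrite -subr_eq0 -raddfB /=; apply/eqP/theta0_eq0.
by rewrite raddfB /= eq_fg subrr.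
Qed.

Lemma theta_psi alpha : theta (psi (schurred svar alpha)) = coords n (alternant C alpha).
Proof. by rewrite theta_toA /theta0 phi_pvars schurred_mesyms. Qed.

Definition thetaV (u : ext_power C k n) : A :=
  \sum_a (u a : C) *: psi (schurred svar (seq_nat a)).

Lemma thetaVK : cancel thetaV theta.
Proof.
move=> u; rewrite raddf_sum /=; apply/ffunP=> b; rewrite sum_ffunE (bigD1 b) //=.
rewrite big1 ?addr0 => [|a ne_ab]; rewrite linearZ /= ffunE theta_psi coords_basis.
  by rewrite eqxx [_ *: _]mulr1.
by rewrite (negbTE ne_ab) scaler0.
Qed.

Lemma thetaK : cancel theta thetaV.
Proof. by move=> x; apply: theta_inj; rewrite thetaVK. Qed.

Lemma theta_schubert lam :
  theta (schubert C n lam) = wedge (fun i => evec C n (lam i + (k - i.+1))).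
Proof. by rewrite schubertE // theta_psi coords_alternant. Qed.

Lemma incr_seq_le (a : incr_seq k n) (i j : 'I_k) :
  (i <= j)%N -> (seq_nat a i + (j - i) <= seq_nat a j)%N.
Proof.
move=> le_ij; have [d def_j] : exists d, (j = i + d :> nat)%N by exists (j - i)%N; rewrite subnKC.
rewrite def_j addKn; elim: d j {le_ij} def_j => [|d IHd] j def_j.
  by rewrite addn0 (_ : i = j) //; apply/val_inj; rewrite /= def_j addn0.
have lt_d : (i + d < k)%N by rewrite (leq_trans _ (ltn_ord j)) // def_j addnS.
rewrite addnS (leq_ltn_trans (IHd (Ordinal lt_d) erefl)) //.
have /forallP/(_ (Ordinal lt_d))/forallP/(_ j)/implyP := valP a; apply.
by rewrite /= def_j addnS.
Qed.

(** Read backwards, [a] is decreasing and equals lam + delta for a partition in the box; the sign is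
    that of the reversal. *)
Lemma psi_schubert (a : incr_seq k n) :
  exists (lam : 'I_k -> nat) (s : 'S_k), in_box n lam /\
    psi (schurred svar (seq_nat a)) = (-1) ^+ s *: schubert C n lam.
Proof.
pose s : 'S_k := perm (@rev_ord_inj k).
pose lam (i : 'I_k) := (seq_nat a (rev_ord i) - (k - i.+1))%N.
have lam_rev i : (lam i + (k - i.+1) = seq_nat a (s i))%N.
  rewrite /lam permE subnK //.
  have := @incr_seq_le a (Ordinal k0) (rev_ord i); rewrite subn0 /=.
  by move/(_ (leq0n _)); apply: leq_trans; rewrite leq_addl.
exists lam, s; split.
  split=> [i j le_ij|i].
    have := @incr_seq_le a (rev_ord j) (rev_ord i).
    rewrite /lam /= => /(_ (leq_sub2l _ _)); move/(_ le_ij).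
    by have := ltn_ord i; have := ltn_ord j; lia.
  have lt_k1 : (k.-1 < k)%N by rewrite ltn_predL.
  have := @incr_seq_le a (rev_ord i) (Ordinal lt_k1).
  have := ltn_ord (val a (Ordinal lt_k1)); rewrite -/(seq_nat a (Ordinal lt_k1)) /lam /=.
  by have := ltn_ord i; lia.
have -> : schubert C n lam = psi ((-1) ^+ s * schurred svar (seq_nat a)).
  rewrite schubertE // -[in RHS]schurred_perm; congr (psi (\det _)).
  by apply/matrixP=> i j; rewrite !mxE lam_rev.
rewrite -(rmorph_sign (@mpolyC k C)) mul_mpolyC psiZ scalerA -signr_addb addbb.
by rewrite scale1r.
Qed.

(** By [thetaK] and [psi_schubert] the Schubert classes span A, so their prescribed images leave no
    choice. *)
Lemma schubert_iso_unique (th : {linear A -> ext_power C k n}) thV :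
  schubert_iso th thV -> th =1 theta.
Proof.
case=> _ _ th_schubert x; rewrite -(thetaK x) !raddf_sum; apply: eq_bigr => a _ /=.
rewrite !linearZ /=; congr (_ *: _).
have [lam [s [box ->]]] := psi_schubert a.
by rewrite !linearZ /= th_schubert // theta_schubert.
Qed.

(** The kernel of [theta0] is the ideal of relations, so an operator intertwined with the action of
    [X] preserves this ideal and induces the transported operator. *)
Lemma schubert_iso_descends (th : {linear A -> ext_power C k n}) thV
    (D : pq_poly C k n -> pq_poly C k n) (X : 'M[C]_n) :
    schubert_iso th thV ->
    (forall f, theta0 (D f) = ext_act X (theta0 f)) ->
  descends_to D (transport th thV X).
Proof.
move=> iso thD; have th_theta := schubert_iso_unique iso; split=> f; last first.
  rewrite /transport th_theta theta_toA -thD -theta_toA -th_theta.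
  by case: iso => ->.
rewrite -!toA_eq0 => /eqP/theta0_eq0 f0; apply/eqP/theta0_eq0.
by rewrite thD f0 /ext_act big1 // => a _; rewrite ffunE scale0r.
Qed.

Lemma theta0_diffF f : theta0 (diffF f) = ext_act (dynkin_f C n) (theta0 f).
Proof.
rewrite /theta0 phi_diffF (ext_act_coords (@opFX C k) (@dynkin_f_evec C n)) //.
  by move=> m le_nm; right; apply: leqW.
exact: antisym_phi.
Qed.

Lemma theta0_diffH f : theta0 (diffH f) = ext_act (dynkin_h C n) (theta0 f).
Proof.
rewrite /theta0 phi_diffH // (ext_act_coords (sh := id) (@opHX C k n) (@dynkin_h_evec C n)) //.
  by move=> m; right.
exact: antisym_phi.
Qed.

Lemma theta0_diffE f : theta0 (diffE f) = ext_act (dynkin_e C n) (theta0 f).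
Proof.
rewrite /theta0 (ext_act_coords (@opEX C k n) (@dynkin_e_evec C n) (@tauE_ge C n)) //.
  apply/eqP; rewrite -subr_eq0 -raddfB /=; apply/eqP/vanish_coords; exact: phi_diffE.
exact: antisym_phi.
Qed.

End Iso.

Theorem proposition1p6 (R : realType) (n k : nat)
    (k_ge1 : (1 <= k)%N) (k_le : (k <= n - 1)%N) :
  (exists (theta : {linear algA R[i] k n -> ext_power R[i] k n})
          (thetaV : ext_power R[i] k n -> algA R[i] k n),
      schubert_iso theta thetaV) /\
  (forall (theta : {linear algA R[i] k n -> ext_power R[i] k n})
          (thetaV : ext_power R[i] k n -> algA R[i] k n),
      schubert_iso theta thetaV ->
      let H := transport theta thetaV (dynkin_h R[i] n) in
      let E := transport theta thetaV (dynkin_e R[i] n) in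
      let F := transport theta thetaV (dynkin_f R[i] n) in
      [/\ descends_to (@diffH R[i] k n) H,
          descends_to (@diffE R[i] k n) E &
          descends_to (@diffF R[i] k n) F]).
Proof.
have le_kn : (k <= n)%N := leq_trans k_le (leq_subr _ _).
have char0 : [pchar R[i]] =i pred0 := Num.Theory.pchar_num _.
split=> [|th thV iso H E F].
  exists (linear_theta char0 k_ge1 le_kn), (@thetaV _ k n); split.
  - exact: thetaK.
  - exact: thetaVK.
  - by move=> lam _; apply: theta_schubert.
split; apply: schubert_iso_descends iso _ => // f.
- exact: theta0_diffH.
- exact: theta0_diffE.
- exact: theta0_diffF.
Qed.
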